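(* Let $R$ and $S$ be associative rings and let ${}_SC_R$ be a semidualizing $(S,R)$-bimodule. (a) The classes $\mathcal{A}_C(R)$ and $\mathcal{B}_C(S)$ are closed under direct summands, products, coproducts, and filtered colimits. (b) The classes $\mathcal{A}_C^f(R)$ and $\mathcal{B}_C^f(S)$ are closed under finite direct sums and direct summands.
   Context: Rings are associative with unity (not necessarily commutative or noetherian). Modules are unital left modules; right $R$-modules are identified with left $R^{\mathrm{op}}$-modules. For a class $\mathcal{X}$ of modules, $\mathcal{X}^f$ is the subclass of finitely generated modules in $\mathcal{X}$. An $(S,R)$-bimodule $C={}_SC_R$ is semidualizing if: (a1) ${}_SC$ admits a degreewise finite $S$-projective resolution (a projective resolution by finitely generated projectives); (a2) $C_R$ admits a degreewise finite $R^{\mathrm{op}}$-projective resolution; (b1) the homothety map $S\to\operatorname{Hom}_{R^{\mathrm{op}}}(C,C)$, $s\mapsto(x\mapsto sx)$, is an isomorphism; (b2) the homothety map $R\to\operatorname{Hom}_S(C,C)$, $r\mapsto(x\mapsto xr)$, is an isomorphism; (c1) $\operatorname{Ext}_S^{i}(C,C)=0$ for all $i\geq1$; (c2) $\operatorname{Ext}_{R^{\mathrm{op}}}^{i}(C,C)=0$ for all $i\geq 1$. The Auslander class $\mathcal{A}_C(R)$ consists of all $R$-modules $M$ with (A1) $\operatorname{Tor}^R_i(C,M)=0$ for all $i\ge1$; (A2) $\operatorname{Ext}_S^i(C,C\otimes_RM)=0$ for all $i\ge1$; (A3) the natural map $\mu_M\colon M\to\operatorname{Hom}_S(C,C\otimes_RM)$,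 $m\mapsto(c\mapsto c\otimes m)$, is an isomorphism. The Bass class $\mathcal{B}_C(S)$ consists of all $S$-modules $N$ with (B1) $\operatorname{Ext}_S^i(C,N)=0$ for all $i\ge1$; (B2) $\operatorname{Tor}_i^R(C,\operatorname{Hom}_S(C,N))=0$ for all $i\ge1$; (B3) the natural evaluation map $\nu_N\colon C\otimes_R\operatorname{Hom}_S(C,N)\to N$, $c\otimes f\mapsto f(c)$, is an isomorphism. *)

(* Defs.v *)
From HB Require Import structures.
From mathcomp Require Import all_boot all_order all_algebra.
From mathcomp Require Import boolp functions.
From mathcomp.multinomials Require Import freeg.

Set Implicit Arguments.
Unset Strict Implicit.
Unset Printing Implicit Defensive.

Import GRing.Theory.
Local Open Scope ring_scope.
Local Open Scope quotient_scope.

(* Rings are [pzRingType]s, so the zero ring is allowed. Left R-modules are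
   [lmodType R]; right R-modules are [lmodType R^c], where r *: x stands for
   the product x r. *)

Definition surj (A B : Type) (f : A -> B) : Prop := forall y, exists x, f x = y.

Section modHom.
Variables (R : pzRingType) (U V : lmodType R).

Definition hom_pred : {pred U -> V} := fun f => `[< linear f >].

Lemma hom_pred_zmod_closed : zmod_closed hom_pred.
Proof.
split; first by apply/asboolP => a x y; rewrite scaler0 addr0.
move=> f g /asboolP lf /asboolP lg; apply/asboolP => a x y.
by rewrite !fctE lf lg scalerBr opprD addrACA.
Qed.

HB.instance Definition _ :=
  GRing.isZmodClosed.Build (U -> V) hom_pred hom_pred_zmod_closed.

Record modHom : Type := MkHom { hom_fun :> U -> V; hom_funP : hom_fun \in hom_pred }.

HB.instance Definition _ := [isSub for hom_fun].
HB.instance Definition _ := [Choice of modHom by <:].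
HB.instance Definition _ := [SubChoice_isSubZmodule of modHom by <:].

Definition mk_hom (f : U -> V) (lf : linear f) : modHom := MkHom (introT (asboolP _) lf).

Lemma hom_linear (f : modHom) : linear f.
Proof. exact/asboolP/hom_funP. Qed.

End modHom.

Section Tensor.
Variables (R : pzRingType) (U : lmodType R^c) (V : lmodType R).

Local Notation fab := {freeg (U * V) / int}.
Local Notation gen u v := (<< ((u, v) : U * V) >> : fab).

(* The subgroup of the free abelian group on U * V generated by the
   bilinearity and balancing relations; [r : R^c] makes [r *: u] the right
   multiple u r. *)
Inductive tensor_rel : fab -> Prop :=
| tensor_rel0 : tensor_rel 0
| tensor_relB x y : tensor_rel x -> tensor_rel y -> tensor_rel (x - y)
| tensor_relDl u u' v : tensor_rel (gen (u + u') v - gen u v - gen u' v)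
| tensor_relDr u v v' : tensor_rel (gen u (v + v') - gen u v - gen u v')
| tensor_relZ (r : R) u v :
    tensor_rel (gen ((r : R^c) *: u) v - gen u (r *: v)).

Definition tensor_pred : {pred fab} := fun x => `[< tensor_rel x >].

Lemma tensor_pred_zmod_closed : zmod_closed tensor_pred.
Proof.
split; first exact/asboolP/tensor_rel0.
by move=> x y /asboolP xP /asboolP yP; exact/asboolP/tensor_relB.
Qed.

HB.instance Definition _ :=
  GRing.isZmodClosed.Build fab tensor_pred tensor_pred_zmod_closed.

Definition tensor : Type := Quotient.quot tensor_pred.
HB.instance Definition _ := GRing.Zmodule.on tensor.

Definition tens (u : U) (v : V) : tensor :=
  \pi_(Quotient.quot tensor_pred) (gen u v).

Definition balanced (A : zmodType) (f : U -> V -> A) : Prop :=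
  [/\ forall u u' v, f (u + u') v = f u v + f u' v,
      forall u v v', f u (v + v') = f u v + f u v'
    & forall (r : R) u v, f ((r : R^c) *: u) v = f u (r *: v)].

(* Meaningful only for balanced f: see [tensor_liftE] and [tensor_lift_zmod]. *)
Definition tensor_lift (A : zmodType) (f : U -> V -> A) (x : tensor) : A :=
  fglift (fun uv : U * V => f uv.1 uv.2 : zmodule A) (repr x).

End Tensor.

Section TensorTheory.
Variables (R : pzRingType) (U : lmodType R^c) (V : lmodType R).
Local Notation fab := {freeg (U * V) / int}.
Local Notation tensor := (tensor U V).
Local Notation pi := (\pi_(Quotient.quot (@tensor_pred R U V)) : fab -> tensor).
Implicit Types (u : U) (v : V) (x y : tensor).

Lemma tensor_piB (a b : fab) : pi (a - b) = pi a - pi b.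
Proof. exact: raddfB. Qed.

Lemma tensor_pi_eq (a b : fab) : tensor_rel (a - b) -> pi a = pi b.
Proof.
move=> ab; apply/eqP; rewrite -[_ == _]/(_ == _ %[mod _]) -Quotient.idealrBE.
exact/asboolP.
Qed.

Lemma tensDl u u' v : tens (u + u') v = tens u v + tens u' v :> tensor.
Proof.
have /asboolP := tensor_relDl u u' v.
rewrite -[`[< _ >]]/(_ \in @tensor_pred R U V) Quotient.idealrBE => /eqP E.
rewrite [RHS]addrC -[tens u' v]E; apply/esym.
by rewrite -[LHS]/(pi _ + pi _) -raddfD subrK.
Qed.

Lemma tensDr u v v' : tens u (v + v') = tens u v + tens u v' :> tensor.
Proof.
have /asboolP := tensor_relDr u v v'.
rewrite -[`[< _ >]]/(_ \in @tensor_pred R U V) Quotient.idealrBE => /eqP E.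
rewrite [RHS]addrC -[tens u v']E; apply/esym.
by rewrite -[LHS]/(pi _ + pi _) -raddfD subrK.
Qed.

Lemma tensZ (r : R) u v : tens ((r : R^c) *: u) v = tens u (r *: v).
Proof. exact/tensor_pi_eq/tensor_relZ. Qed.

Lemma tens_balanced : balanced (@tens R U V).
Proof. by split=> *; [apply: tensDl | apply: tensDr | apply: tensZ]. Qed.

Section Lift.
Variables (A : zmodType) (f : U -> V -> A).
Hypothesis f_bal : balanced f.
Let g := fun uv : U * V => f uv.1 uv.2 : zmodule A.

Let gB : zmod_morphism (fglift g : fab -> zmodule A) := lift_is_additive g.

Lemma fglift_gen u v : fglift g << ((u, v) : U * V) >> = f u v.
Proof. by rewrite liftU scale1r. Qed.

Lemma fglift_rel (a : fab) : tensor_rel a -> fglift g a = 0.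
Proof.
case: f_bal => fDl fDr fZ; elim=> [|x y _ hx _ hy|u u' v|u v v'|r u v].
- by rewrite -(subrr 0) gB subrr.
- by rewrite gB hx hy subr0.
- by rewrite !gB !fglift_gen fDl addrAC addrK subrr.
- by rewrite !gB !fglift_gen fDr addrAC addrK subrr.
- by rewrite gB !fglift_gen fZ subrr.
Qed.

Lemma tensor_lift_pi (a : fab) : tensor_lift f (pi a) = fglift g a.
Proof.
apply/eqP; rewrite -subr_eq0 -gB; apply/eqP/fglift_rel/asboolP.
by have := Quotient.idealrBE (@tensor_pred R U V) (repr (pi a)) a;
  rewrite reprK eqxx.
Qed.

Lemma tensor_liftE u v : tensor_lift f (tens u v) = f u v.
Proof. by rewrite [LHS]tensor_lift_pi fglift_gen. Qed.

Lemma tensor_lift_zmod : zmod_morphism (tensor_lift f).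
Proof.
move=> x y; rewrite -[x]reprK -[y]reprK -[LHS]/(tensor_lift f (pi _ - pi _)).
by rewrite -tensor_piB !tensor_lift_pi gB.
Qed.

End Lift.

Lemma tensor_ext (A : zmodType) (h k : tensor -> A) :
    zmod_morphism h -> zmod_morphism k ->
  (forall u v, h (tens u v) = k (tens u v)) -> h =1 k.
Proof.
move=> hB kB hk x; rewrite -[x]reprK.
pose h' : tensor -> A := h; pose k' : tensor -> A := k.
pose mh := GRing.isZmodMorphism.Build _ _ h' hB.
pose mk := GRing.isZmodMorphism.Build _ _ k' kB.
pose H : {additive tensor -> A} := HB.pack h' mh.
pose K : {additive tensor -> A} := HB.pack k' mk.
rewrite -[LHS]/(H (pi (repr x))) -[RHS]/(K (pi (repr x))).
rewrite -(freeg_sumE (repr x)) !raddf_sum; apply: eq_bigr => -[u v] _.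
have -> z : << z *g (u, v) >> = (<< (u, v) >> : fab) *~ z.
  by rewrite freegU_mulz intz.
rewrite !raddfMz; congr (_ *~ _); exact: hk.
Qed.

End TensorTheory.

Record bimodule (S R : pzRingType) := Bimodule {
  bim_left :> lmodType S;
  ract : bim_left -> R -> bim_left;
  ractA : forall c r r', ract (ract c r) r' = ract c (r * r');
  ract1 : forall c, ract c 1 = c;
  ractDl : forall c c' r, ract (c + c') r = ract c r + ract c' r;
  ractDr : forall c r r', ract c (r + r') = ract c r + ract c r';
  ract_scale : forall s c r, ract (s *: c) r = s *: ract c r
}.

Section RightModule.
Variables (S R : pzRingType) (C : bimodule S R).

Definition right_mod : Type := C.
HB.instance Definition _ := GRing.Zmodule.on right_mod.

Let rscale (r : R^c) (c : right_mod) : right_mod := ract c r.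

Let rscaleA a b v : rscale a (rscale b v) = rscale (a * b) v.
Proof. exact: ractA. Qed.
Let rscale1 : left_id 1 rscale.
Proof. exact: ract1. Qed.
Let rscaleDr : right_distributive rscale +%R.
Proof. by move=> r c c'; exact: ractDl. Qed.
Let rscaleDl v : {morph rscale^~ v: a b / a + b}.
Proof. by move=> a b; exact: ractDr. Qed.

HB.instance Definition _ := GRing.Zmodule_isLmodule.Build R^c right_mod
  rscaleA rscale1 rscaleDr rscaleDl.

End RightModule.

Section BimoduleTensor.
Variables (S R : pzRingType) (C : bimodule S R) (M : lmodType R).

Definition btensor : Type := tensor (right_mod C) M.
HB.instance Definition _ := GRing.Zmodule.on btensor.

Definition btens (c : C) (m : M) : btensor := tens (c : right_mod C) m.

Let sact (s : S) (x : btensor) : btensor :=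
  tensor_lift (fun (c : right_mod C) m => btens (s *: (c : C)) m) x.

Let sact_bal s :
  balanced (fun (c : right_mod C) (m : M) => btens (s *: (c : C)) m).
Proof.
split=> [c c' m|c m m'|r c m]; rewrite /btens.
- by rewrite -tensDl; congr tens; exact: (@scalerDr S C s c c').
- exact: tensDr.
- by rewrite -tensZ; congr tens; exact/esym/ract_scale.
Qed.

Let sactE s c m : sact s (btens c m) = btens (s *: c) m.
Proof. exact/tensor_liftE/sact_bal. Qed.

Let sactB s : zmod_morphism (sact s).
Proof. exact/tensor_lift_zmod/sact_bal. Qed.

Let sactA a b v : sact a (sact b v) = sact (a * b) v.
Proof.
apply: (@tensor_ext _ (right_mod C) M _ (sact a \o sact b)) => [x y||c m].
- by rewrite /= !sactB.
- exact: sactB.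
- by rewrite /= -![tens c m]/(btens c m) !sactE scalerA.
Qed.

Let sact1 : left_id 1 sact.
Proof.
apply: (@tensor_ext _ (right_mod C) M _ (sact 1) id) => // [|c m].
- exact: sactB.
- by rewrite -![tens c m]/(btens c m) sactE scale1r.
Qed.

Let sactDr : right_distributive sact +%R.
Proof.
move=> s x y; apply/eqP; rewrite -subr_eq -sactB; apply/eqP; congr sact.
exact: addrK.
Qed.

Let sactDl v : {morph sact^~ v: a b / a + b}.
Proof.
move=> a b; apply: (@tensor_ext _ (right_mod C) M _
  (sact (a + b)) (fun x => sact a x + sact b x)) => [|x y|c m].
- exact: sactB.
- by rewrite !sactB opprD addrACA.
- rewrite -![tens c m]/(btens c m) !sactE scalerDl; exact: tensDl.
Qed.

HB.instance Definition _ := GRing.Zmodule_isLmodule.Build S btensor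
  sactA sact1 sactDr sactDl.

Lemma btensZ s c m : s *: btens c m = btens (s *: c) m.
Proof. exact: sactE. Qed.

End BimoduleTensor.

Section BimoduleHom.
Variables (S R : pzRingType) (C : bimodule S R) (N : lmodType S).

Definition bhom : Type := modHom C N.
HB.instance Definition _ := GRing.Zmodule.on bhom.

Lemma bhom_scale_linear (r : R) (f : modHom C N) :
  linear (fun c : C => f (ract c r)).
Proof. by move=> a x y; rewrite ractDl ract_scale hom_linear. Qed.

Let hscale (r : R) (f : bhom) : bhom := mk_hom (bhom_scale_linear r f).

Let hom_ext (f g : bhom) : (f : C -> N) =1 (g : C -> N) -> f = g.
Proof. by move=> fg; apply/val_inj/funext. Qed.

Let hscaleA a b f : hscale a (hscale b f) = hscale (a * b) f.
Proof. by apply: hom_ext => c /=; rewrite ractA. Qed.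
Let hscale1 : left_id 1 hscale.
Proof. by move=> f; apply: hom_ext => c /=; rewrite ract1. Qed.
Let hscaleDr : right_distributive hscale +%R.
Proof. by move=> r f g; apply: hom_ext. Qed.
Let hscaleDl f : {morph hscale^~ f: a b / a + b}.
Proof.
move=> a b; apply: hom_ext => c /=.
rewrite ractDr; have := hom_linear f 1 (ract c a) (ract c b).
by rewrite !scale1r.
Qed.

HB.instance Definition _ := GRing.Zmodule_isLmodule.Build R bhom
  hscaleA hscale1 hscaleDr hscaleDl.

End BimoduleHom.

Section NaturalMaps.
Variables (S R : pzRingType) (C : bimodule S R).

Lemma lmult_linear (s : S) :
  linear (fun c : right_mod C => s *: (c : C) : right_mod C).
Proof.
by move=> r x y; rewrite [LHS]scalerDr; congr (_ + _); exact/esym/ract_scale.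
Qed.
Definition homothety_l (s : S) : modHom (right_mod C) (right_mod C) :=
  mk_hom (lmult_linear s).

Lemma rmult_linear (r : R) : linear (fun c : C => ract c r).
Proof. by move=> s x y; rewrite ractDl ract_scale. Qed.
Definition homothety_r (r : R) : modHom C C := mk_hom (rmult_linear r).

Lemma mu_linear (M : lmodType R) (m : M) : linear (fun c : C => btens c m).
Proof. by move=> s x y; rewrite btensZ; exact: tensDl. Qed.
Definition mu (M : lmodType R) (m : M) : bhom C (btensor C M) :=
  mk_hom (mu_linear m).

Definition nu (N : lmodType S) : btensor C (bhom C N) -> N :=
  tensor_lift (fun (c : right_mod C) (f : bhom C N) => (f : modHom C N) c).

Lemma nu_balanced (N : lmodType S) :
  balanced (fun (c : right_mod C) (f : bhom C N) => (f : modHom C N) c).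
Proof.
split=> // c c' f; have := hom_linear (f : modHom C N) 1 c c'.
by rewrite !scale1r.
Qed.

Lemma nuE (N : lmodType S) c (f : bhom C N) : nu (btens c f) = (f : modHom C N) c.
Proof. exact/tensor_liftE/nu_balanced. Qed.

End NaturalMaps.

Section Homological.
Variable R : pzRingType.

Definition fin_gen (M : lmodType R) : Prop :=
  exists n (x : 'I_n -> M), forall m, exists a : 'I_n -> R,
    m = \sum_i a i *: x i.

Definition projective (P : lmodType R) : Prop :=
  forall (A B : lmodType R) (g : {linear A -> B}) (f : {linear P -> B}),
    surj g -> exists h : {linear P -> A}, forall x, g (h x) = f x.

Record proj_res (M : lmodType R) := ProjRes {
  pr_obj :> nat -> lmodType R;
  pr_d : forall n, {linear pr_obj n.+1 -> pr_obj n};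
  pr_aug : {linear pr_obj 0 -> M};
  pr_proj : forall n, projective (pr_obj n);
  pr_aug_surj : surj pr_aug;
  pr_exact0 : forall x, pr_aug x = 0 <-> exists y, pr_d 0 y = x;
  pr_exact : forall n x, pr_d n x = 0 <-> exists y, pr_d n.+1 y = x
}.

Definition degreewise_finite (M : lmodType R) (P : proj_res M) : Prop :=
  forall n, fin_gen (P n).

Section Ext.
Variables (M N : lmodType R) (P : proj_res M).

Definition ext_cocycle i (f : {linear P i -> N}) : Prop :=
  forall x, f (pr_d P i x) = 0.

Definition ext_coboundary i : {linear P i -> N} -> Prop :=
  match i with
  | 0 => fun f => forall x, f x = 0
  | j.+1 => fun f => exists g : {linear P j -> N}, forall x, f x = g (pr_d P j x)
  end.

End Ext.

(* Ext^i_R(M, N) = H^i(Hom_R(P, N)) for a projective resolution P of M; every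
   M has one and the vanishing does not depend on P, so quantifying over all P
   is the same as fixing one. *)
Definition Ext_eq0 (i : nat) (M N : lmodType R) : Prop :=
  forall (P : proj_res M) (f : {linear P i -> N}),
    ext_cocycle f -> ext_coboundary f.

End Homological.

Definition tensor_map (R : pzRingType) (U U' : lmodType R^c) (V : lmodType R)
    (f : {linear U -> U'}) : tensor U V -> tensor U' V :=
  tensor_lift (fun u v => tens (f u) v).

Section Tor.
Variables (R : pzRingType) (U : lmodType R^c) (V : lmodType R) (P : proj_res U).

Definition tor_cycle i : tensor (P i) V -> Prop :=
  match i with
  | 0 => fun _ => True
  | j.+1 => fun x => tensor_map (pr_d P j) x = 0
  end.

Definition tor_boundary i (x : tensor (P i) V) : Prop :=
  exists y, tensor_map (pr_d P i) y = x.

End Tor.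

(* Tor_i^R(U, V) = H_i(P (x)_R V) for a projective resolution P of the right
   module U, with P quantified as for Ext. *)
Definition Tor_eq0 (R : pzRingType) (i : nat) (U : lmodType R^c)
    (V : lmodType R) : Prop :=
  forall (P : proj_res U) (x : tensor (P i) V), tor_cycle x -> tor_boundary x.

Record semidualizing (S R : pzRingType) (C : bimodule S R) : Prop := {
  sd_a1 : exists P : proj_res C, degreewise_finite P;
  sd_a2 : exists P : proj_res (right_mod C), degreewise_finite P;
  sd_b1 : bijective (homothety_l C);
  sd_b2 : bijective (homothety_r C);
  sd_c1 : forall i, (1 <= i)%N -> Ext_eq0 i C C;
  sd_c2 : forall i, (1 <= i)%N -> Ext_eq0 i (right_mod C) (right_mod C)
}.

(* The natural maps mu and nu are linear, hence isomorphisms exactly when they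
   are bijective; likewise for the two homothety ring morphisms above. *)
Record auslander (S R : pzRingType) (C : bimodule S R) (M : lmodType R) : Prop := {
  aus_A1 : forall i, (1 <= i)%N -> Tor_eq0 i (right_mod C) M;
  aus_A2 : forall i, (1 <= i)%N -> Ext_eq0 i C (btensor C M);
  aus_A3 : bijective (@mu S R C M)
}.

Record bass (S R : pzRingType) (C : bimodule S R) (N : lmodType S) : Prop := {
  bass_B1 : forall i, (1 <= i)%N -> Ext_eq0 i C N;
  bass_B2 : forall i, (1 <= i)%N -> Tor_eq0 i (right_mod C) (bhom C N);
  bass_B3 : bijective (@nu S R C N)
}.

Definition fg_part (R : pzRingType) (X : lmodType R -> Prop) (M : lmodType R) : Prop :=
  X M /\ fin_gen M.

Record category := Category {
  cat_obj :> Type;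
  cat_hom : cat_obj -> cat_obj -> Type;
  cat_id : forall i, cat_hom i i;
  cat_comp : forall i j k, cat_hom i j -> cat_hom j k -> cat_hom i k;
  cat_idl : forall i j (u : cat_hom i j), cat_comp (cat_id i) u = u;
  cat_idr : forall i j (u : cat_hom i j), cat_comp u (cat_id j) = u;
  cat_assoc : forall i j k l (u : cat_hom i j) (v : cat_hom j k) (w : cat_hom k l),
    cat_comp u (cat_comp v w) = cat_comp (cat_comp u v) w
}.

Definition filtered (J : category) : Prop :=
  [/\ exists i : J, True,
      forall i j : J, exists k (u : cat_hom i k) (v : cat_hom j k), True
    & forall (i j : J) (u v : cat_hom i j), exists k (w : cat_hom j k),
        cat_comp u w = cat_comp v w].

Section Limits.
Variable R : pzRingType.

Record diagram (J : category) := Diagram {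
  dg_obj :> J -> lmodType R;
  dg_map : forall i j, cat_hom i j -> {linear dg_obj i -> dg_obj j};
  dg_id : forall i x, dg_map (cat_id i) x = x;
  dg_comp : forall i j k (u : cat_hom i j) (v : cat_hom j k) x,
    dg_map (cat_comp u v) x = dg_map v (dg_map u x)
}.

Definition is_product (I : Type) (M : I -> lmodType R) (P : lmodType R)
    (p : forall i, {linear P -> M i}) : Prop :=
  forall (X : lmodType R) (f : forall i, {linear X -> M i}),
    exists h : {linear X -> P},
      (forall i x, p i (h x) = f i x) /\
      (forall h' : {linear X -> P},
         (forall i x, p i (h' x) = f i x) -> h' =1 h).

Definition is_coproduct (I : Type) (M : I -> lmodType R) (Q : lmodType R)
    (q : forall i, {linear M i -> Q}) : Prop :=
  forall (X : lmodType R) (f : forall i, {linear M i -> X}),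
    exists h : {linear Q -> X},
      (forall i x, h (q i x) = f i x) /\
      (forall h' : {linear Q -> X},
         (forall i x, h' (q i x) = f i x) -> h' =1 h).

Definition is_cocone (J : category) (D : diagram J) (Q : lmodType R)
    (q : forall i, {linear D i -> Q}) : Prop :=
  forall i j (u : cat_hom i j) x, q j (dg_map D u x) = q i x.

Definition is_colimit (J : category) (D : diagram J) (Q : lmodType R)
    (q : forall i, {linear D i -> Q}) : Prop :=
  is_cocone q /\
  forall (X : lmodType R) (f : forall i, {linear D i -> X}), is_cocone f ->
    exists h : {linear Q -> X},
      (forall i x, h (q i x) = f i x) /\
      (forall h' : {linear Q -> X},
         (forall i x, h' (q i x) = f i x) -> h' =1 h).

Definition direct_summand (N M : lmodType R) : Prop :=
  exists (N' : lmodType R) (e : {linear (N * N')%type -> M}), bijective e.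

Variable X : lmodType R -> Prop.

Definition closed_summands : Prop :=
  forall M N : lmodType R, X M -> direct_summand N M -> X N.

Definition closed_products : Prop :=
  forall (I : Type) (M : I -> lmodType R) (P : lmodType R)
    (p : forall i, {linear P -> M i}),
    is_product p -> (forall i, X (M i)) -> X P.

Definition closed_coproducts : Prop :=
  forall (I : Type) (M : I -> lmodType R) (Q : lmodType R)
    (q : forall i, {linear M i -> Q}),
    is_coproduct q -> (forall i, X (M i)) -> X Q.

Definition closed_filtered_colimits : Prop :=
  forall (J : category) (D : diagram J) (Q : lmodType R)
    (q : forall i, {linear D i -> Q}),
    filtered J -> is_colimit q -> (forall i, X (D i)) -> X Q.

(* A finite direct sum is a coproduct of finitely many modules; n = 0 gives
   the zero module. *)
Definition closed_finite_sums : Prop :=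
  forall (n : nat) (M : 'I_n -> lmodType R) (Q : lmodType R)
    (q : forall i, {linear M i -> Q}),
    is_coproduct q -> (forall i, X (M i)) -> X Q.

End Limits.

(* Main.v *)
Require Import Defs.
From HB Require Import structures.
From mathcomp Require Import all_boot all_order all_algebra.
From mathcomp Require Import boolp.

(** The conditions defining the two classes say that certain sequences of
natural transformations between functors built from [C (x)_R -], [Hom_S(C, -)]
and the terms of projective resolutions of [C] are exact, or invertible, at the
given module. Vanishing of Ext and Tor may be tested on a single resolution, so
one can take a degreewise finite one. A finitely generated projective [P] has a
finite dual basis, which makes [P (x) -] and [Hom(P, -)] natural retracts of a
finite power of the identity; hence these functors commute with products and
filtered colimits. Presenting [C] by such modules, so do [C (x)_R -] and
[Hom_S(C, -)], and then the locus of exactness or invertibility is closed under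
products and filtered colimits. A direct summand of [M] is the filtered colimit
of an idempotent of [M], and a coproduct is the directed union of its finite
subproducts. *)

Set Implicit Arguments.
Unset Strict Implicit.
Unset Printing Implicit Defensive.

Import GRing.Theory.
Local Open Scope ring_scope.
Local Open Scope quotient_scope.

(** * Functors commuting with products and filtered colimits *)

Lemma dep_choice I (A : I -> Type) (P : forall i, A i -> Prop) :
  (forall i, exists x, P i x) -> exists f : forall i, A i, forall i, P i (f i).
Proof. by move=> h; exists (fun i => projT1 (cid (h i))) => i; case: cid. Qed.

Lemma bijective_inj_surj (A B : Type) (f : A -> B) :
  injective f -> surj f -> bijective f.
Proof.
move=> fI fS; have [g gK] := dep_choice fS.
by exists g => // x; apply/fI/gK.
Qed.

Section ZmodMorphism.
Variables (A B : zmodType) (f : A -> B).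
Hypothesis fB : zmod_morphism f.

Lemma zmor0 : f 0 = 0.
Proof. by rewrite -(subrr 0) fB subrr. Qed.

Lemma zmorN x : f (- x) = - f x.
Proof. by rewrite -sub0r fB zmor0 sub0r. Qed.

Lemma zmorD x y : f (x + y) = f x + f y.
Proof. by rewrite -{1}[y]opprK fB zmorN opprK. Qed.

Lemma zmor_sum I (r : seq I) (F : I -> A) : f (\sum_(i <- r) F i) = \sum_(i <- r) f (F i).
Proof. by elim: r => [|i r IH]; rewrite ?big_nil ?big_cons ?zmor0 // zmorD IH. Qed.

Lemma zmor_inj : (forall x, f x = 0 -> x = 0) -> injective f.
Proof.
by move=> f0 x y /eqP; rewrite -subr_eq0 -fB => /eqP/f0/eqP; rewrite subr_eq0 => /eqP.
Qed.

End ZmodMorphism.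

Lemma zmorDP (A B : zmodType) (f : A -> B) :
  {morph f : x y / x + y} -> zmod_morphism f.
Proof. by move=> fD x y; apply/eqP; rewrite -subr_eq opprK -fD subrK. Qed.

(** The identity and composition laws quantify over every linear map that agrees pointwise with an
    identity or a composite. So [fmap] respects pointwise equality, and no equation between bundled
    linear maps is ever required. *)
Record functor (R : pzRingType) := Functor {
  fobj :> lmodType R -> zmodType;
  fmap : forall M N : lmodType R, {linear M -> N} -> fobj M -> fobj N;
  fmapB : forall (M N : lmodType R) (f : {linear M -> N}), zmod_morphism (fmap f);
  fmap_id : forall (M : lmodType R) (f : {linear M -> M}),
    (forall x, f x = x) -> forall x, fmap f x = x;
  fmap_comp : forall (M N L : lmodType R) (f : {linear M -> N}) (g : {linear N -> L})
    (h : {linear M -> L}),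
    (forall x, h x = g (f x)) -> forall x, fmap h x = fmap g (fmap f x)
}.
Arguments fmap {R} F {M N} _ _ : rename.

Record lfunctor (R S : pzRingType) := LFunctor {
  lobj :> lmodType R -> lmodType S;
  lmap : forall M N : lmodType R, {linear M -> N} -> {linear lobj M -> lobj N};
  lmap_id : forall (M : lmodType R) (f : {linear M -> M}),
    (forall x, f x = x) -> forall x, lmap f x = x;
  lmap_comp : forall (M N L : lmodType R) (f : {linear M -> N}) (g : {linear N -> L})
    (h : {linear M -> L}),
    (forall x, h x = g (f x)) -> forall x, lmap h x = lmap g (lmap f x)
}.
Arguments fmapB {R F M N} f _ _ : rename.
Arguments lmap {R S} T {M N} _ : rename.

Record nattrans (R : pzRingType) (F G : functor R) := NatTrans {
  ntr :> forall M, F M -> G M;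
  ntrB : forall M, zmod_morphism (@ntr M);
  ntr_nat : forall (M N : lmodType R) (f : {linear M -> N}) x,
    ntr (fmap F f x) = fmap G f (ntr x)
}.

Arguments ntrB {R F G} a {M} _ _ : rename.

Section Functors.
Variable R : pzRingType.
Implicit Types (F G H : functor R).

Definition Idf : functor R.
Proof.
by apply: (@Functor R (fun M => M) (fun M N f => f)) => // M N f; exact: raddfB.
Defined.

Section Composition.
Variables (S : pzRingType) (G : functor S) (T : lfunctor R S).

Definition compf : functor R.
Proof.
apply: (@Functor R (fun M => G (T M)) (fun M N f => fmap G (lmap T f))).
- by move=> M N f; exact: fmapB.
- by move=> M f fE x; apply: fmap_id; exact: lmap_id.
- by move=> M N L f g h hE x; apply: fmap_comp; exact: lmap_comp.
Defined.

Definition dg_push (J : category) (D : diagram R J) : diagram S J.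
Proof.
apply: (@Diagram S J (fun j => T (D j)) (fun i j u => lmap T (dg_map D u))).
- by move=> i x; apply: lmap_id; exact: dg_id.
- by move=> i j k u v x; apply: lmap_comp; exact: dg_comp.
Defined.

End Composition.

(** The two halves say that the comparison map from [F P] to the product of the [F (M i)] is
    injective and surjective. With [F] the identity functor, [P] itself is the product. *)
Definition prodcone F (I : Type) (M : I -> lmodType R) (P : lmodType R)
    (p : forall i, {linear P -> M i}) : Prop :=
  (forall x, (forall i, fmap F (p i) x = 0) -> x = 0) /\
  (forall y : forall i, F (M i), exists x, forall i, fmap F (p i) x = y i).

(** For a filtered [J] and a cocone [q], this is the elementwise form of [F Q] being the colimit of
    the groups [F (D j)]: surjectivity and injectivity of the comparison map. *)
Definition dirlim F (J : category) (D : diagram R J) (Q : lmodType R)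
    (q : forall j, {linear D j -> Q}) : Prop :=
  (forall x, exists j y, fmap F (q j) y = x) /\
  (forall j (y : F (D j)), fmap F (q j) y = 0 ->
     exists k (u : cat_hom j k), fmap F (dg_map D u) y = 0).

Record bicontinuous F : Prop := Bicontinuous {
  bicontinuous_prod : forall I (M : I -> lmodType R) (P : lmodType R)
      (p : forall i, {linear P -> M i}),
    prodcone Idf p -> prodcone F p;
  bicontinuous_lim : forall J (D : diagram R J) (Q : lmodType R)
      (q : forall j, {linear D j -> Q}),
    filtered J -> is_cocone q -> dirlim Idf q -> dirlim F q
}.

Lemma bicontinuous_Idf : bicontinuous Idf.
Proof. by []. Qed.

Definition exact (A B D : zmodType) (f : A -> B) (g : B -> D) : Prop :=
  forall y, g y = 0 -> exists x, f x = y.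

(** The cones are given elementwise and not by universal properties, so that idempotents and finite
    supports can be fed in directly. *)
Record limclosed (X : lmodType R -> Prop) : Prop := LimClosed {
  lim_prod : forall I (M : I -> lmodType R) (P : lmodType R)
      (p : forall i, {linear P -> M i}),
    prodcone Idf p -> (forall i, X (M i)) -> X P;
  lim_lim : forall J (D : diagram R J) (Q : lmodType R)
      (q : forall j, {linear D j -> Q}),
    filtered J -> is_cocone q -> dirlim Idf q -> (forall j, X (D j)) -> X Q
}.

Section NaturalSequence.
Variables (F G H : functor R) (a : nattrans F G) (b : nattrans G H).

Lemma fmap_cocone (F0 : functor R) J (D : diagram R J) (Q : lmodType R)
    (q : forall j, {linear D j -> Q}) :
  is_cocone q -> forall i j (u : cat_hom i j) x,
  fmap F0 (q j) (fmap F0 (dg_map D u) x) = fmap F0 (q i) x.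
Proof. by move=> qc i j u x; rewrite -(fmap_comp (h := q i)). Qed.

Lemma fmap_dg_comp (F0 : functor R) J (D : diagram R J) i j k
    (u : cat_hom i j) (v : cat_hom j k) x :
  fmap F0 (dg_map D (cat_comp u v)) x = fmap F0 (dg_map D v) (fmap F0 (dg_map D u) x).
Proof. by apply: fmap_comp => y; exact: dg_comp. Qed.

(** For products, preimages are chosen componentwise and assembled in [F P]. For colimits, an
    element killed by [b] comes from a stage, its image under [b] dies at a later stage, and
    exactness there gives the preimage. *)
Lemma limclosed_exact : bicontinuous F -> bicontinuous G -> bicontinuous H ->
  limclosed (fun M => exact (@ntr _ _ _ a M) (@ntr _ _ _ b M)).
Proof.
move=> gF gG gH; split=> [I M P p pp ex | J D Q q fJ qc qq ex] y by0.
- have h i : exists x, a (M i) x = fmap G (p i) y.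
    by apply: ex; rewrite ntr_nat by0 (zmor0 (fmapB _)).
  have [x hx] := dep_choice h.
  have [z hz] := (bicontinuous_prod gF pp).2 x; exists z.
  apply/eqP; rewrite -subr_eq0; apply/eqP/(bicontinuous_prod gG pp).1 => i.
  by rewrite fmapB -ntr_nat hz hx subrr.
- have [j [y' yE]] := (bicontinuous_lim gG fJ qc qq).1 y.
  have [k [u hu]] : exists k (u : cat_hom j k), fmap H (dg_map D u) (b _ y') = 0.
    by apply: (bicontinuous_lim gH fJ qc qq).2; rewrite -ntr_nat yE.
  have [x hx] : exists x, a _ x = fmap G (dg_map D u) y' by apply: ex; rewrite ntr_nat.
  by exists (fmap F (q k) x); rewrite ntr_nat hx fmap_cocone.
Qed.

Lemma limclosed_bij : bicontinuous F -> bicontinuous G -> limclosed (fun M => bijective (@ntr _ _ _ a M)).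
Proof.
move=> gF gG; split=> [I M P p pp ex | J D Q q fJ qc qq ex];
  (apply: bijective_inj_surj; first apply: (zmor_inj (ntrB a))).
- move=> x ax0; apply: (bicontinuous_prod gF pp).1 => i.
  by apply: (bij_inj (ex i)); rewrite ntr_nat ax0 !(zmor0 (fmapB _)) (zmor0 (ntrB a)).
- move=> y; have h i : exists x, a (M i) x = fmap G (p i) y.
    by have [g _ gK] := ex i; exists (g (fmap G (p i) y)).
  have [x hx] := dep_choice h; have [z hz] := (bicontinuous_prod gF pp).2 x; exists z.
  apply/eqP; rewrite -subr_eq0; apply/eqP/(bicontinuous_prod gG pp).1 => i.
  by rewrite fmapB -ntr_nat hz hx subrr.
- move=> x; have [j [x' <-]] := (bicontinuous_lim gF fJ qc qq).1 x.
  rewrite ntr_nat => /(bicontinuous_lim gG fJ qc qq).2 [k [u]].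
  rewrite -ntr_nat -(zmor0 (ntrB a)) => /(bij_inj (ex k)) x0.
  by rewrite -(@fmap_cocone F _ _ _ _ qc _ _ u) x0 (zmor0 (fmapB _)).
- move=> y; have [j [y' <-]] := (bicontinuous_lim gG fJ qc qq).1 y.
  have [g _ gK] := ex j; exists (fmap F (q j) (g y')).
  by rewrite ntr_nat gK.
Qed.

(** Here [F] is the kernel of [b], and kernels commute with products and with filtered colimits. *)
Lemma bicontinuous_ker : (forall M, injective (@ntr _ _ _ a M)) ->
  (forall M, exact (@ntr _ _ _ a M) (@ntr _ _ _ b M)) ->
  (forall M x, b M (a M x) = 0) -> bicontinuous G -> bicontinuous H -> bicontinuous F.
Proof.
move=> aI ex ba0 gG gH; split=> [I M P p pp | J D Q q fJ qc qq]; split.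
- move=> x x0; apply: aI; rewrite (zmor0 (ntrB a)).
  apply: (bicontinuous_prod gG pp).1 => i; rewrite -ntr_nat x0; exact: zmor0 (ntrB a).
- move=> y; have [z hz] := (bicontinuous_prod gG pp).2 (fun i => a _ (y i)).
  have /ex [x xE] : b _ z = 0.
    by apply: (bicontinuous_prod gH pp).1 => i; rewrite -ntr_nat hz ba0.
  by exists x => i; apply: aI; rewrite ntr_nat xE.
- move=> x; have [j [y yE]] := (bicontinuous_lim gG fJ qc qq).1 (a _ x).
  have /(bicontinuous_lim gH fJ qc qq).2 [k [u]] : fmap H (q j) (b _ y) = 0.
    by rewrite -ntr_nat yE ba0.
  rewrite -ntr_nat => /ex [x' x'E]; exists k, x'; apply: aI.
  by rewrite ntr_nat x'E fmap_cocone.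
- move=> j x x0; have /(bicontinuous_lim gG fJ qc qq).2 [k [u]] : fmap G (q j) (a _ x) = 0.
    by rewrite -ntr_nat x0 (zmor0 (ntrB a)).
  rewrite -ntr_nat -(zmor0 (ntrB a)) => /aI ?.
  by exists k, u.
Qed.

(** Here [H] is the cokernel of [a]. Cokernels commute with colimits, and also with products, since
    preimages can be chosen in all components at once. *)
Lemma bicontinuous_coker : (forall M, surj (@ntr _ _ _ b M)) ->
  (forall M, exact (@ntr _ _ _ a M) (@ntr _ _ _ b M)) ->
  (forall M x, b M (a M x) = 0) -> bicontinuous F -> bicontinuous G -> bicontinuous H.
Proof.
move=> bS ex ba0 gF gG; split=> [I M P p pp | J D Q q fJ qc qq]; split.
- move=> x; have [y <-] := bS _ x => y0.
  have h i : exists z, a (M i) z = fmap G (p i) y by apply: ex; rewrite ntr_nat y0.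
  have [z hz] := dep_choice h; have [w hw] := (bicontinuous_prod gF pp).2 z.
  suff -> : y = a _ w by rewrite ba0.
  apply/eqP; rewrite -subr_eq0; apply/eqP/(bicontinuous_prod gG pp).1 => i.
  by rewrite fmapB -ntr_nat hw hz subrr.
- move=> y; have [z hz] := dep_choice (fun i => bS _ (y i)).
  have [w hw] := (bicontinuous_prod gG pp).2 z.
  by exists (b _ w) => i; rewrite -ntr_nat hw hz.
- move=> x; have [y <-] := bS _ x; have [j [z <-]] := (bicontinuous_lim gG fJ qc qq).1 y.
  by exists j, (b _ z); rewrite ntr_nat.
- move=> j x; have [y <-] := bS _ x; rewrite -ntr_nat => /ex [z].
  (* The stage [k] of [w] is unrelated to the stage [j] of [y]. Both move to a common stage [l],
     where [y] and the image of [w] under [a] may still differ; the difference dies at [m], and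
     there [b] kills [y]. *)
  have [k [w <-]] := (bicontinuous_lim gF fJ qc qq).1 z.
  have [_ ub _] := fJ; have [l [u [v _]]] := ub j k.
  rewrite -(@fmap_cocone F _ _ _ _ qc _ _ v) ntr_nat.
  rewrite -(@fmap_cocone G _ _ _ _ qc _ _ u) => /eqP.
  rewrite eq_sym -subr_eq0 -fmapB => /eqP/(bicontinuous_lim gG fJ qc qq).2 [m [t]].
  rewrite fmapB => /eqP; rewrite subr_eq0 -fmap_dg_comp => /eqP E.
  by exists m, (cat_comp u t); rewrite -ntr_nat E -!ntr_nat ba0.
Qed.

End NaturalSequence.

Lemma limclosedI (X Y : lmodType R -> Prop) :
  limclosed X -> limclosed Y -> limclosed (fun M => X M /\ Y M).
Proof.
move=> [Xp Xl] [Yp Yl]; split=> [I M P p pp h | J D Q q fJ qc qq h]; split.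
- by apply: (Xp _ _ _ _ pp) => i; case: (h i).
- by apply: (Yp _ _ _ _ pp) => i; case: (h i).
- by apply: (Xl _ _ _ _ fJ qc qq) => i; case: (h i).
- by apply: (Yl _ _ _ _ fJ qc qq) => i; case: (h i).
Qed.

Lemma limclosed_forall (T : Type) (X : T -> lmodType R -> Prop) :
  (forall t, limclosed (X t)) -> limclosed (fun M => forall t, X t M).
Proof.
move=> Xc; split=> [I M P p pp h t | J D Q q fJ qc qq h t].
- by apply: (lim_prod (Xc t) pp) => i; apply: h.
- by apply: (lim_lim (Xc t) fJ qc qq) => i; apply: h.
Qed.

Lemma limclosed_ext (X Y : lmodType R -> Prop) :
  (forall M, X M <-> Y M) -> limclosed X -> limclosed Y.
Proof.
move=> XY [Xp Xl]; split=> [I M P p pp h | J D Q q fJ qc qq h]; apply/XY.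
- by apply: (Xp _ _ _ _ pp) => i; apply/XY.
- by apply: (Xl _ _ _ _ fJ qc qq) => i; apply/XY.
Qed.

End Functors.

(** * Tensor and Hom functors *)

Section PowerFunctor.
Variables (R : pzRingType) (n : nat).

Definition powerf : functor R.
Proof.
apply: (@Functor R (fun M => {ffun 'I_n -> M}) (fun M N f x => [ffun i => f (x i)])).
- by move=> M N f x y; apply/ffunP => i; rewrite !ffunE raddfB.
- by move=> M f fE x; apply/ffunP => i; rewrite ffunE fE.
- by move=> M N L f g h hE x; apply/ffunP => i; rewrite !ffunE.
Defined.

Lemma bicontinuous_powerf : bicontinuous powerf.
Proof.
split=> [I M P p [p0 pS] | J D Q q fJ qc [q0 qS]]; split.
- move=> x x0; apply/ffunP => i; rewrite ffunE; apply: p0 => j.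
  by have /ffunP/(_ i) := x0 j; rewrite !ffunE.
- move=> y; have [x hx] := dep_choice (fun i : 'I_n => pS (fun j => y j i)).
  by exists [ffun i => x i] => j; apply/ffunP => i; rewrite !ffunE; exact: hx.
(* Induction on the number [m] of coordinates lifted to a single stage: the next coordinate lifts at
   some [k], and an upper bound of [j] and [k] carries them all. The second half below treats
   vanishing of coordinates in the same way. *)
- move=> x; suff /(_ n) [j [y yE]] : forall m, exists j (y : {ffun 'I_n -> D j}),
      forall i : 'I_n, (i < m)%N -> q j (y i) = x i.
    by exists j, y; apply/ffunP => i; rewrite ffunE yE.
  elim=> [|m [j [y yE]]].
    by have [[j _] _ _] := fJ; exists j, 0.
  have [mn|nm] := ltnP m n; last by exists j, y => i _; apply: yE; exact: leq_trans nm.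
  have [k [z zE]] := q0 (x (Ordinal mn)); have [_ ub _] := fJ.
  have [l [u [v _]]] := ub j k.
  exists l, [ffun i : 'I_n => if i == m :> nat then dg_map D v z else dg_map D u (y i)].
  move=> i; rewrite ffunE ltnS leq_eqVlt; case: eqP => [im _|_ im] /=.
    by rewrite qc [LHS]zE; congr (x _); apply: val_inj.
  by rewrite qc yE.
- move=> j y y0; suff /(_ n) [k [u hu]] : forall m, exists k (u : cat_hom j k),
      forall i : 'I_n, (i < m)%N -> dg_map D u (y i) = 0.
    by exists k, u; apply/ffunP => i; rewrite !ffunE hu.
  elim=> [|m [k [u uE]]]; first by exists j, (cat_id j).
  have [mn|nm] := ltnP m n; last by exists k, u => i _; apply: uE; exact: leq_trans nm.
  have [|l [v vE]] := qS k (dg_map D u (y (Ordinal mn))).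
    by have /ffunP/(_ (Ordinal mn)) := y0; rewrite !ffunE /= qc.
  exists l, (cat_comp u v) => i; rewrite ltnS leq_eqVlt dg_comp => /predU1P[im|/uE->].
    by rewrite -[RHS]vE; congr (dg_map _ _ (dg_map _ _ (y _))); apply: val_inj.
  exact: raddf0.
Qed.

End PowerFunctor.

Section Retract.
Variables (R : pzRingType) (F G : functor R) (i : nattrans F G) (r : nattrans G F).

Definition retract_defect : nattrans G G.
Proof.
apply: (@NatTrans _ G G (fun M y => y - i M (r M y))).
- by move=> M x y; rewrite !ntrB !opprD !opprK addrACA.
- by move=> M N f x; rewrite fmapB !ntr_nat.
Defined.

(* [F] is the kernel of [1 - i r] on [G]. *)
Lemma bicontinuous_retract : (forall M x, r M (i M x) = x) -> bicontinuous G -> bicontinuous F.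
Proof.
move=> rK gG; apply: (@bicontinuous_ker _ F G G i retract_defect) => // M.
- exact: can_inj (rK M).
- by move=> y /eqP; rewrite subr_eq0 => /eqP yE; exists (r M y).
- by move=> x; rewrite /= rK subrr.
Qed.

End Retract.

HB.instance Definition _ (R : pzRingType) (U V : lmodType R) (f : modHom U V) :=
  GRing.isLinear.Build R U V *:%R (hom_fun f) (hom_linear f).

Definition mk_linear (R : pzRingType) (U V : lmodType R) (f : U -> V) (fl : linear f) :
  {linear U -> V} := mk_hom fl.

Section ModHom.
Variable R : pzRingType.
Implicit Types U V : lmodType R.

Lemma modHomP U V (f g : modHom U V) : (forall x, f x = g x) -> f = g.
Proof. by move=> fg; apply/val_inj/funext. Qed.

Definition lin_hom U V (f : {linear U -> V}) : modHom U V := mk_hom (linearP f).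

Definition hom_pre U U' V (f : {linear U -> U'}) (g : modHom U' V) : modHom U V :=
  lin_hom (g \o f).

Definition homf U : functor R.
Proof.
apply: (@Functor R (fun V => modHom U V) (fun V W f g => lin_hom (f \o g))).
- by move=> V W f g h; apply: modHomP => x /=; rewrite raddfB.
- by move=> V f fE g; apply: modHomP => x /=; rewrite fE.
- by move=> V W L f g h hE x; apply: modHomP => y /=; rewrite hE.
Defined.

Definition hom_pre_nt U U' (f : {linear U -> U'}) : nattrans (homf U') (homf U).
Proof.
by apply: (@NatTrans _ (homf U') (homf U) (fun V => @hom_pre U U' V f)) => // V;
  move=> *; apply: modHomP.
Defined.

End ModHom.

Section TensorFunctor.
Variable R : pzRingType.
Implicit Types (U : lmodType R^c) (V : lmodType R).

Lemma tens_zmorr U V (u : U) : zmod_morphism (fun v : V => tens u v).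
Proof. by apply: zmorDP => x y; exact: tensDr. Qed.

Lemma tens_zmorl U V (v : V) : zmod_morphism (fun u : U => tens u v).
Proof. by apply: zmorDP => x y; exact: tensDl. Qed.

Lemma tensor_mapr_bal U V V' (g : {linear V -> V'}) :
  balanced (fun (u : U) v => tens u (g v)).
Proof.
split=> [u u' v|u v v'|r u v]; first exact: tensDl.
- by rewrite raddfD; exact: tensDr.
- by rewrite tensZ linearZ.
Qed.

Lemma tensor_map_bal U U' V (f : {linear U -> U'}) :
  balanced (fun u (v : V) => tens (f u) v).
Proof.
split=> [u u' v|u v v'|r u v]; last by rewrite linearZ; exact: tensZ.
- by rewrite raddfD; exact: tensDl.
- exact: tensDr.
Qed.

Lemma tensor_mapE U U' V (f : {linear U -> U'}) u v :
  tensor_map f (tens u v) = tens (f u) v :> tensor U' V.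
Proof. exact/tensor_liftE/tensor_map_bal. Qed.

Lemma tensor_mapB U U' V (f : {linear U -> U'}) :
  zmod_morphism (tensor_map f : tensor U V -> tensor U' V).
Proof. exact/tensor_lift_zmod/tensor_map_bal. Qed.

Definition tensor_mapr U V V' (g : {linear V -> V'}) : tensor U V -> tensor U V' :=
  tensor_lift (fun u v => tens u (g v)).

Lemma tensor_maprE U V V' (g : {linear V -> V'}) u v :
  tensor_mapr g (tens u v) = tens u (g v) :> tensor U V'.
Proof. exact/tensor_liftE/tensor_mapr_bal. Qed.

Lemma tensor_maprB U V V' (g : {linear V -> V'}) :
  zmod_morphism (tensor_mapr g : tensor U V -> tensor U V').
Proof. exact/tensor_lift_zmod/tensor_mapr_bal. Qed.

Lemma zmor_comp (A B D : zmodType) (f : A -> B) (g : B -> D) :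
  zmod_morphism f -> zmod_morphism g -> zmod_morphism (g \o f).
Proof. by move=> fB gB x y; rewrite /= fB gB. Qed.

Definition tensorf U : functor R.
Proof.
apply: (@Functor R (fun V => tensor U V) (fun V W f => @tensor_mapr U V W f)).
- by move=> V W f; exact: tensor_maprB.
- move=> V f fE; apply: tensor_ext => // [|u v]; first exact: tensor_maprB.
  by rewrite tensor_maprE fE.
- move=> V W L f g h hE; apply: (@tensor_ext _ _ _ _ _ (tensor_mapr g \o tensor_mapr f)).
  + exact: tensor_maprB.
  + by apply: zmor_comp; exact: tensor_maprB.
  + by move=> u v; rewrite /= !tensor_maprE hE.
Defined.

Definition tensor_map_nt U U' (f : {linear U -> U'}) : nattrans (tensorf U) (tensorf U').
Proof.
apply: (@NatTrans _ (tensorf U) (tensorf U') (fun V => @tensor_map R U U' V f)).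
- by move=> V; exact: tensor_mapB.
- move=> V W g; apply: (@tensor_ext _ _ _ _
    (tensor_map f \o tensor_mapr g) (tensor_mapr g \o tensor_map f)).
  + by apply: zmor_comp; [exact: tensor_maprB | exact: tensor_mapB].
  + by apply: zmor_comp; [exact: tensor_mapB | exact: tensor_maprB].
  + by move=> u v; rewrite /= tensor_maprE !tensor_mapE tensor_maprE.
Defined.

End TensorFunctor.

(** The generators give a surjection from a free module onto [P]; projectivity splits it, and the
    [phi k] are the coordinates of the splitting. *)
Lemma dual_basis (R : pzRingType) (P : lmodType R) :
  projective P -> fin_gen P ->
  exists n (u : 'I_n -> P) (phi : 'I_n -> {linear P -> R^o}),
    forall x, x = \sum_k (phi k x : R) *: u k.
Proof.
move=> prP [n [u uP]].
have gl : linear (fun a : 'rV[R]_n => \sum_k a 0 k *: u k).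
  move=> c a b; rewrite scaler_sumr -big_split /=; apply: eq_bigr => k _.
  by rewrite !mxE scalerDl scalerA.
pose g : {linear 'rV[R]_n -> P} := mk_linear gl.
have gS : surj g.
  move=> m; have [a ->] := uP m; exists (\row_k a k).
  by apply: eq_bigr => k _; rewrite mxE.
have [h hK] := prP _ _ g idfun gS.
have hl k : linear (fun x => h x 0 k : R^o) by move=> c x y; rewrite linearP !mxE.
pose phi k : {linear P -> R^o} := mk_linear (hl k).
by exists n, u, phi => x; rewrite -{1}[x]/(idfun x) -hK.
Qed.

Section FinitelyGeneratedProjective.
Variable R : pzRingType.

Section Hom.
Variables (P : lmodType R) (n : nat) (u : 'I_n -> P) (phi : 'I_n -> {linear P -> R^o}).

Definition hom_coord : nattrans (homf P) (powerf R n).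
Proof.
apply: (@NatTrans _ (homf P) (powerf R n) (fun V f => [ffun k => (f : modHom P V) (u k)])).
- by move=> V f g; apply/ffunP => k; rewrite !ffunE.
- by move=> V W f x; apply/ffunP => k; rewrite !ffunE.
Defined.

Lemma hom_uncoord_linear (V : lmodType R) (y : 'I_n -> V) :
  linear (fun x => \sum_k (phi k x : R) *: y k).
Proof.
move=> c a b; rewrite scaler_sumr -big_split /=; apply: eq_bigr => k _.
by rewrite linearP scalerDl scalerA.
Qed.

(** When [u] and [phi] form a dual basis, this is a left inverse of [hom_coord], since a linear map
    is determined by its values on the [u k] through the expansion of [x]. *)
Definition hom_uncoord : nattrans (powerf R n) (homf P).
Proof.
apply: (@NatTrans _ (powerf R n) (homf P) (fun V y => mk_hom (hom_uncoord_linear y))).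
- move=> V y z; apply: modHomP => x.
  rewrite -[RHS]/(\sum_k (phi k x : R) *: y k - \sum_k (phi k x : R) *: z k) -sumrB.
  by apply: eq_bigr => k _; rewrite !ffunE scalerBr.
- move=> V W f y; apply: modHomP => x /=; rewrite linear_sum; apply: eq_bigr => k _.
  by rewrite ffunE linearZ.
Defined.

End Hom.

Lemma bicontinuous_homf_fgproj (P : lmodType R) : projective P -> fin_gen P -> bicontinuous (homf P).
Proof.
move=> prP fgP; have [n [u [phi uK]]] := dual_basis prP fgP.
apply: (bicontinuous_retract (i := hom_coord u) (r := hom_uncoord phi)) (bicontinuous_powerf R n).
move=> V f; apply: modHomP => x /=; rewrite [in RHS](uK x) linear_sum.
by apply: eq_bigr => k _; rewrite ffunE linearZ.
Qed.

Section Tensor.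
Variables (P : lmodType R^c) (n : nat) (u : 'I_n -> P).
Variable phi : 'I_n -> {linear P -> (R^c)^o}.

Definition coord V (k : 'I_n) : tensor P V -> V :=
  tensor_lift (fun (x : P) (v : V) => (phi k x : R) *: v).

(** Linearity of [phi k] over [R^c] reads, in [R], as [phi k] of [x r] being [phi k x * r]; this is
    exactly the balancing condition. *)
Lemma coord_bal (V : lmodType R) k : balanced (fun (x : P) (v : V) => (phi k x : R) *: v).
Proof.
split=> [x x' v|x v v'|r x v]; [by rewrite raddfD scalerDl | exact: scalerDr |].
by rewrite linearZ [RHS]scalerA.
Qed.

Lemma coordE V k x v : @coord V k (tens x v) = (phi k x : R) *: v.
Proof. exact/tensor_liftE/coord_bal. Qed.

Lemma coordB V k : zmod_morphism (@coord V k).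
Proof. exact/tensor_lift_zmod/coord_bal. Qed.

Definition tensor_coord : nattrans (tensorf P) (powerf R n).
Proof.
apply: (@NatTrans _ (tensorf P) (powerf R n) (fun V x => [ffun k => coord k x])).
- by move=> V x y; apply/ffunP => k; rewrite !ffunE coordB.
- move=> V W f x; apply/ffunP => k; rewrite !ffunE.
  move: x; apply: (@tensor_ext _ _ _ _ (@coord _ k \o tensor_mapr f) (f \o @coord _ k)).
  + by apply: zmor_comp; [exact: tensor_maprB | exact: coordB].
  + by apply: zmor_comp; [exact: coordB | exact: raddfB].
  + by move=> x v; rewrite /= tensor_maprE !coordE linearZ.
Defined.

Definition tensor_uncoord : nattrans (powerf R n) (tensorf P).
Proof.
apply: (@NatTrans _ (powerf R n) (tensorf P)
  (fun V (y : {ffun 'I_n -> V}) => \sum_k tens (u k) (y k) : tensor P V)).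
- move=> V y z; rewrite -sumrB; apply: eq_bigr => k _.
  by rewrite !ffunE tens_zmorr.
- move=> V W f y; rewrite [RHS](zmor_sum (@tensor_maprB _ _ _ _ f)).
  by apply: eq_bigr => k _; rewrite ffunE tensor_maprE.
Defined.

End Tensor.

Lemma bicontinuous_tensorf_fgproj (P : lmodType R^c) : projective P -> fin_gen P -> bicontinuous (tensorf P).
Proof.
move=> prP fgP; have [n [u [phi uK]]] := dual_basis prP fgP.
apply: (bicontinuous_retract (i := tensor_coord phi) (r := tensor_uncoord u)) (bicontinuous_powerf R n).
move=> V; apply: (@tensor_ext _ _ _ _ (tensor_uncoord u V \o tensor_coord phi V) id) => //.
  exact: (zmor_comp (@ntrB _ _ _ (tensor_coord phi) V) (@ntrB _ _ _ (tensor_uncoord u) V)).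
move=> x v; rewrite [in RHS](uK x) [RHS](zmor_sum (@tens_zmorl _ _ _ v)) /=.
by apply: eq_bigr => k _; rewrite ffunE coordE tensZ.
Qed.

End FinitelyGeneratedProjective.

(** * Right exactness of the tensor product *)

Record subgroup (A : zmodType) := Subgroup {
  sg_in :> A -> Prop;
  sg0 : sg_in 0;
  sgB : forall x y, sg_in x -> sg_in y -> sg_in (x - y)
}.

Definition image_subgroup (A B : zmodType) (f : A -> B) (fB : zmod_morphism f) : subgroup B.
Proof.
apply: (@Subgroup B (fun y => exists x, f x = y)).
- by exists 0; exact: zmor0.
- by move=> _ _ [x <-] [y <-]; exists (x - y).
Defined.

Section Quotient.
Variables (A : zmodType) (N : subgroup A).

Definition sg_pred : {pred A} := fun x => `[< N x >].

Lemma sg_pred_zmod_closed : zmod_closed sg_pred.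
Proof.
split; first exact/asboolP/sg0.
by move=> x y /asboolP xN /asboolP yN; exact/asboolP/sgB.
Qed.

HB.instance Definition _ := GRing.isZmodClosed.Build A sg_pred sg_pred_zmod_closed.

Definition quotz : Type := Quotient.quot sg_pred.
HB.instance Definition _ := GRing.Zmodule.on quotz.

Definition quot_pi (x : A) : quotz := \pi_(Quotient.quot sg_pred) x.

Lemma quot_piB : zmod_morphism quot_pi.
Proof. by move=> x y; exact: raddfB. Qed.

Lemma quot_pi_eq x y : quot_pi x = quot_pi y <-> N (x - y).
Proof.
have E := Quotient.idealrBE sg_pred x y; split=> [/eqP xy|xyN].
  by apply/asboolP; move: xy; rewrite /quot_pi -[_ == _]/(_ == _ %[mod _]) -E.
by apply/eqP; rewrite -[_ == _]/(_ == _ %[mod _]) -E; exact/asboolP.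
Qed.

Lemma quot_pi_eq0 x : quot_pi x = 0 <-> N x.
Proof. by rewrite -(zmor0 quot_piB) quot_pi_eq subr0. Qed.

Lemma quot_piS : surj quot_pi.
Proof. by move=> y; exists (repr y); rewrite /quot_pi reprK. Qed.

End Quotient.

Section RightExact.
Variables (R : pzRingType) (U1 U0 U : lmodType R^c) (V : lmodType R).
Variables (f : {linear U1 -> U0}) (e : {linear U0 -> U}).
Hypotheses (eS : surj e) (ex : forall x, e x = 0 -> exists y, f y = x).

(** The projection onto the quotient by the image vanishes on pure tensors, hence everywhere. *)
Lemma tensor_map_surj : surj (tensor_map e : tensor U0 V -> tensor U V).
Proof.
pose N := image_subgroup (@tensor_mapB _ _ _ V e).
suff pi0 y : quot_pi N y = 0 by move=> y; exact/(quot_pi_eq0 N)/pi0.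
move: y; apply: (@tensor_ext _ _ _ _ _ (fun _ => 0)).
- exact: quot_piB.
- by move=> *; rewrite subr0.
- move=> u v; apply/(quot_pi_eq0 N); have [w <-] := eS u.
  by exists (tens w v); exact: tensor_mapE.
Qed.

(** An inverse to the map induced by [e] on the quotient by the image of [f] is built on pure
    tensors from a set-theoretic section of [e]. *)
Lemma tensor_map_exact :
  exact (tensor_map f : tensor U1 V -> tensor U0 V) (tensor_map e : _ -> tensor U V).
Proof.
pose N := image_subgroup (@tensor_mapB _ _ _ V f).
(* Two lifts of the same element differ by a value of [f], so the class of a lift is independent of
   the choice; this makes [k] balanced although the section [s] is not linear. *)
have piE p p' v : e p = e p' -> quot_pi N (tens p v) = quot_pi N (tens p' v).
  move=> pp'; apply/quot_pi_eq; have [|y yE] := ex (x := p - p').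
    by rewrite linearB pp' subrr.
  by exists (tens y v); rewrite tensor_mapE yE; exact: tens_zmorl.
have [s sK] := dep_choice eS.
pose k u v := quot_pi N (tens (s u) v).
have kbal : balanced k.
  split=> [u u' v|u v v'|r u v]; rewrite /k.
  - by rewrite -(zmorD (@quot_piB _ N)) -tensDl; apply: piE; rewrite linearD !sK.
  - by rewrite tensDr (zmorD (@quot_piB _ N)).
  - by rewrite -tensZ; apply: piE; rewrite linearZ !sK.
move=> y y0; apply/(quot_pi_eq0 N).
suff -> : quot_pi N y = tensor_lift k (tensor_map e y).
  by rewrite y0 (zmor0 (tensor_lift_zmod kbal)).
move: y {y0}; apply: (@tensor_ext _ _ _ _ _ (tensor_lift k \o tensor_map e)).
- exact: quot_piB.
- apply: zmor_comp; [exact: tensor_mapB | exact: tensor_lift_zmod].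
- by move=> u v; rewrite /= tensor_mapE tensor_liftE //; apply: piE; rewrite sK.
Qed.

End RightExact.

Lemma tensor_map_comp0 (R : pzRingType) (U1 U0 U : lmodType R^c) (V : lmodType R)
    (f : {linear U1 -> U0}) (e : {linear U0 -> U}) :
  (forall x, e (f x) = 0) ->
  forall x : tensor U1 V, tensor_map e (tensor_map f x) = 0.
Proof.
move=> ef; apply: (@tensor_ext _ _ _ _ (tensor_map e \o tensor_map f) (fun _ => 0)).
- by apply: zmor_comp; exact: tensor_mapB.
- by move=> *; rewrite subr0.
- by move=> u v; rewrite /= !tensor_mapE ef (zmor0 (tens_zmorl _)).
Qed.

(** The start of the resolution presents [U] by finitely generated projectives, and right exactness
    makes [tensorf U] a cokernel. *)
Lemma bicontinuous_tensorf (R : pzRingType) (U : lmodType R^c) (P : proj_res U) :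
  degreewise_finite P -> bicontinuous (tensorf U).
Proof.
move=> fgP; have gP n : bicontinuous (tensorf (P n)).
  by apply: bicontinuous_tensorf_fgproj; [exact: pr_proj | exact: fgP].
apply: (bicontinuous_coker (a := tensor_map_nt (pr_d P 0)) (b := tensor_map_nt (pr_aug P))) => //.
- by move=> V; apply: tensor_map_surj; exact: pr_aug_surj.
- move=> V; apply: tensor_map_exact; first exact: pr_aug_surj.
  by move=> x /pr_exact0.
- by move=> V; apply: tensor_map_comp0 => x; apply/pr_exact0; exists x.
Qed.

(** The factor is [g] after a set-theoretic section of [e]; the kernel condition makes it
    independent of the section, hence linear. *)
Lemma linear_factor (R : pzRingType) (U0 U V : lmodType R) (e : {linear U0 -> U})
    (g : {linear U0 -> V}) :
  surj e -> (forall x, e x = 0 -> g x = 0) ->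
  exists h : {linear U -> V}, forall x, h (e x) = g x.
Proof.
move=> eS eg; have [s sK] := dep_choice eS.
have gE x y : e x = e y -> g x = g y.
  by move=> xy; apply/eqP; rewrite -subr_eq0 -linearB eg // linearB xy subrr.
have hl : linear (fun u => g (s u)).
  by move=> a u u'; rewrite -linearP; apply: gE; rewrite linearP !sK.
by exists (mk_linear hl) => x; apply: gE; rewrite sK.
Qed.

(** By left exactness, [homf U] is the kernel of the map from [homf (P 0)] to [homf (P 1)]. *)
Lemma bicontinuous_homf (R : pzRingType) (U : lmodType R) (P : proj_res U) :
  degreewise_finite P -> bicontinuous (homf U).
Proof.
move=> fgP; have gP n : bicontinuous (homf (P n)).
  by apply: bicontinuous_homf_fgproj; [exact: pr_proj | exact: fgP].
apply: (bicontinuous_ker (a := hom_pre_nt (pr_aug P)) (b := hom_pre_nt (pr_d P 0))) => //.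
- move=> V f g fg; apply: modHomP => x; have [y <-] := pr_aug_surj P x.
  exact: (congr1 (fun h : modHom (P 0) V => h y) fg).
- move=> V f f0; have [|h hE] := linear_factor (g := f) (pr_aug_surj P).
    by move=> x /pr_exact0[y <-]; exact: (congr1 (fun h : modHom (P 1) V => h y) f0).
  by exists (lin_hom h); apply: modHomP => x; exact: hE.
- move=> V f; apply: modHomP => x /=.
  have -> : pr_aug P (pr_d P 0 x) = 0 by apply/pr_exact0; exists x.
  exact: linear0.
Qed.

(** * Module-valued tensor and Hom functors of a bimodule *)

Section BimoduleFunctors.
Variables (S R : pzRingType) (C : bimodule S R).

Lemma bt_map_linear (M N : lmodType R) (g : {linear M -> N}) :
  linear (tensor_mapr g : btensor C M -> btensor C N).
Proof.
move=> s x y; rewrite (zmorD (tensor_maprB g)); congr (_ + _).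
move: x; apply: (@tensor_ext _ (right_mod C) M _
  (tensor_mapr g \o ( *:%R s : btensor C M -> _))
  (( *:%R s : btensor C N -> _) \o tensor_mapr g)).
- by apply: zmor_comp; [exact: (@scalerBr S (btensor C M) s) | exact: tensor_maprB].
- by apply: zmor_comp; [exact: tensor_maprB | exact: (@scalerBr S (btensor C N) s)].
- move=> c m; rewrite /= tensor_maprE.
  rewrite -[tens c m]/(btens c m) -[tens c (g m)]/(btens c (g m)) !btensZ.
  exact: tensor_maprE.
Qed.

Definition btensorl : lfunctor R S.
Proof.
apply: (@LFunctor R S (fun M => btensor C M) (fun M N g => mk_linear (bt_map_linear g))).
- exact: (@fmap_id _ (tensorf (right_mod C))).
- exact: (@fmap_comp _ (tensorf (right_mod C))).
Defined.

Lemma bh_map_linear (M N : lmodType S) (g : {linear M -> N}) :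
  linear (fmap (homf C) g : bhom C M -> bhom C N).
Proof.
move=> r f f'; rewrite (zmorD (fmapB (F := homf C) g)); congr (_ + _).
exact: modHomP.
Qed.

Definition bhoml : lfunctor S R.
Proof.
apply: (@LFunctor S R (fun N => bhom C N) (fun M N g => mk_linear (bh_map_linear g))).
- exact: (@fmap_id _ (homf C)).
- exact: (@fmap_comp _ (homf C)).
Defined.

End BimoduleFunctors.

(** The cone conditions for [compf (Idf S) T] are those for [Idf S] at the image of the cone under
    [T], which is what [G] takes as input. *)
Lemma bicontinuous_compf (R S : pzRingType) (G : functor S) (T : lfunctor R S) :
  bicontinuous (compf (Idf S) T) -> bicontinuous G -> bicontinuous (compf G T).
Proof.
move=> gT gG; split=> [I M P p pp | J D Q q fJ qc qq].
- exact: (bicontinuous_prod gG (bicontinuous_prod gT pp)).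
- apply: (bicontinuous_lim gG (D := dg_push T D) fJ _ (bicontinuous_lim gT fJ qc qq)).
  exact: (@fmap_cocone _ (compf (Idf S) T) _ _ _ _ qc).
Qed.

(** * Projective resolutions *)

Record submodule (R : pzRingType) (M : lmodType R) := Submodule {
  sm_in :> M -> Prop;
  sm0 : sm_in 0;
  smP : forall a x y, sm_in x -> sm_in y -> sm_in (a *: x + y)
}.

Section Submodules.
Variables (R : pzRingType) (M : lmodType R) (N : submodule M).

Definition sm_pred : {pred M} := fun x => `[< N x >].

Lemma sm_pred_closed : GRing.subsemimod_closed sm_pred.
Proof.
split; [split|]; first exact/asboolP/sm0.
- move=> x y /asboolP xN /asboolP yN; apply/asboolP.
  by rewrite -[x]scale1r; exact: smP.
- move=> a x /asboolP xN; apply/asboolP.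
  by rewrite -[a *: x]addr0; apply: smP => //; exact: sm0.
Qed.

HB.instance Definition _ := GRing.isSubmodClosed.Build R M sm_pred sm_pred_closed.

Record subm : Type := SubM { sm_val : M; sm_valP : sm_val \in sm_pred }.

HB.instance Definition _ := [isSub for sm_val].
HB.instance Definition _ := [Choice of subm by <:].
HB.instance Definition _ := [SubChoice_isSubLmodule of subm by <:].

Definition sm_mk (x : M) (xN : N x) : subm := SubM (introT (asboolP _) xN).

Lemma sm_valN (x : subm) : N (sm_val x).
Proof. exact/asboolP/sm_valP. Qed.

Lemma sm_val_linear : linear sm_val.
Proof. by []. Qed.

Definition sm_incl : {linear subm -> M} := mk_linear sm_val_linear.

Lemma sm_val_inj : injective sm_val.
Proof. exact: val_inj. Qed.

Section Corestriction.
Variables (X : lmodType R) (f : {linear X -> M}) (fN : forall x, N (f x)).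

Lemma sm_corestr_linear : linear (fun x => sm_mk (fN x)).
Proof. by move=> a x y; apply: val_inj; rewrite /= linearP. Qed.

Definition sm_corestr : {linear X -> subm} := mk_linear sm_corestr_linear.

End Corestriction.

End Submodules.

Definition image_submodule (R : pzRingType) (A B : lmodType R) (g : {linear A -> B}) :
  submodule B.
Proof.
apply: (@Submodule R B (fun y => exists x, g x = y)).
- by exists 0; exact: linear0.
- by move=> a _ _ [x <-] [y <-]; exists (a *: x + y); exact: linearP.
Defined.

(** Corestricting both maps to the image of [g] makes [g] surjective, so projectivity applies. *)
Lemma projective_lift (R : pzRingType) (P A B : lmodType R) (g : {linear A -> B})
    (f : {linear P -> B}) :
  projective P -> (forall x, exists y, g y = f x) ->
  exists h : {linear P -> A}, forall x, g (h x) = f x.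
Proof.
move=> prP fg; pose N := image_submodule g.
have gN y : N (g y) by exists y.
have [|h hE] := prP _ _ (sm_corestr gN) (sm_corestr (N := N) fg).
  by move=> y; have [x xE] := sm_valN y; exists x; apply: sm_val_inj.
by exists h => x; exact: (congr1 (@sm_val _ _ _) (hE x)).
Qed.

(** Dependent choice along a family of types. The invariant [I] makes each next step possible and is
    packed into a sigma type during the recursion. *)
Lemma dependent_sequence (T : nat -> Type) (I : forall n, T n -> Prop)
    (E : forall n, T n -> T n.+1 -> Prop) (x0 : T 0) :
  I 0 x0 -> (forall n x, I n x -> exists2 y, E n x y & I n.+1 y) ->
  exists2 f : forall n, T n, f 0 = x0 & forall n, E n (f n) (f n.+1).
Proof.
move=> I0 step.
have {}step n (x : {x | I n x}) : exists y : {y | I n.+1 y}, E n (sval x) (sval y).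
  by have [y Ey Iy] := step n _ (svalP x); exists (exist _ y Iy).
pose next n x := projT1 (cid (step n x)).
pose f := nat_rect (fun n => {x | I n x}) (exist _ x0 I0) next.
by exists (fun n => sval (f n)) => // n; exact: (projT2 (cid (step n (f n)))).
Qed.

Section Comparison.
Variables (R : pzRingType).

(** Using the augmentation in degree 0 gives exactness of the resolution one form in all degrees. *)
Definition pr_cycle (M : lmodType R) (P : proj_res M) n : P n -> Prop :=
  match n with 0 => fun x => pr_aug P x = 0 | j.+1 => fun x => pr_d P j x = 0 end.

Lemma pr_cycleP (M : lmodType R) (P : proj_res M) n (x : P n) :
  pr_cycle x <-> exists y, pr_d P n y = x.
Proof. by case: n x => [|n] x; [exact: pr_exact0 | exact: pr_exact]. Qed.

Lemma pr_dd (M : lmodType R) (P : proj_res M) n x : pr_d P n (pr_d P n.+1 x) = 0.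
Proof. by apply/pr_exact; exists x. Qed.

Lemma pr_aug_d (M : lmodType R) (P : proj_res M) x : pr_aug P (pr_d P 0 x) = 0.
Proof. by apply/pr_exact0; exists x. Qed.

Variables (M : lmodType R).

Lemma pr_chain_map (P P' : proj_res M) :
  exists2 phi : forall n, {linear P n -> P' n},
    forall x, pr_aug P' (phi 0 x) = pr_aug P x
    & forall n x, pr_d P' n (phi n.+1 x) = phi n (pr_d P n x).
Proof.
have [|phi0 phi0E] := projective_lift (g := pr_aug P') (f := pr_aug P) (@pr_proj _ _ P 0).
  by move=> x; exact: pr_aug_surj.
(* The invariant, that [f] after the differential lands in cycles of [P'], is what allows the lift
   to degree [n.+1]. *)
have := @dependent_sequence (fun n => {linear P n -> P' n})
  (fun n f => forall x, pr_cycle (f (pr_d P n x)))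
  (fun n f g => forall x, pr_d P' n (g x) = f (pr_d P n x)) phi0.
case=> [x|n f fI|phi phi0' phiE]; first by rewrite /= phi0E pr_aug_d.
- have [|g gE] := projective_lift (g := pr_d P' n) (f := f \o pr_d P n) (@pr_proj _ _ P n.+1).
    by move=> x; apply/pr_cycleP/fI.
  by exists g => // x; rewrite /= gE /= pr_dd linear0.
- by exists phi => //; rewrite phi0'.
Qed.

(** Each [s n] lifts the defect left by the previous one, which is a cycle because [h] is a chain
    map. *)
Lemma pr_null_homotopy (P P' : proj_res M) (h : forall n, {linear P n -> P' n}) :
  (forall x, pr_aug P' (h 0 x) = 0) ->
  (forall n x, pr_d P' n (h n.+1 x) = h n (pr_d P n x)) ->
  exists s : forall n, {linear P n -> P' n.+1},
    forall n x, h n.+1 x = pr_d P' n.+1 (s n.+1 x) + s n (pr_d P n x).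
Proof.
move=> h0 hE.
have [|s0 s0E] := projective_lift (g := pr_d P' 0) (f := h 0) (@pr_proj _ _ P 0).
  by move=> x; apply/pr_exact0.
have := @dependent_sequence (fun n => {linear P n -> P' n.+1})
  (fun n s => forall x, pr_d P' n (h n.+1 x - s (pr_d P n x)) = 0)
  (fun n s t => forall x, h n.+1 x = pr_d P' n.+1 (t x) + s (pr_d P n x)) s0.
case=> [x|n s sI|s _ sE]; last by exists s.
- by rewrite linearB hE s0E subrr.
- have [|t tE] := projective_lift (g := pr_d P' n.+1) (f := h n.+1 \- (s \o pr_d P n))
    (@pr_proj _ _ P n.+1).
    by move=> x; apply/pr_exact/sI.
  exists t => x; first by rewrite tE /= subrK.
  by rewrite linearB tE /= pr_dd linear0 subr0 hE subrr.
Qed.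

(** The difference of the identity of [P'] and [phi] after [psi] is a chain map killed by the
    augmentation. The resulting homotopy on [P'] carries vanishing of homology from [P] to [P']. *)
Lemma pr_homotopy_equiv (P P' : proj_res M) :
  exists (phi : forall n, {linear P n -> P' n}) (psi : forall n, {linear P' n -> P n})
    (s : forall n, {linear P' n -> P' n.+1}),
  [/\ forall n x, pr_d P' n (phi n.+1 x) = phi n (pr_d P n x),
      forall n x, pr_d P n (psi n.+1 x) = psi n (pr_d P' n x)
    & forall n x,
        x = phi n.+1 (psi n.+1 x) + (pr_d P' n.+1 (s n.+1 x) + s n (pr_d P' n x))].
Proof.
have [phi phi0 phiE] := pr_chain_map P P'.
have [psi psi0 psiE] := pr_chain_map P' P.
have [||s sE] := @pr_null_homotopy P' P' (fun n => idfun \- (phi n \o psi n)).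
- by move=> x; rewrite /= linearB /= phi0 psi0 subrr.
- by move=> n x; rewrite /= linearB phiE psiE.
exists phi, psi, s; split=> // n x.
by rewrite -sE /= addrC subrK.
Qed.

Lemma Ext_eq0P (N : lmodType R) (P : proj_res M) n :
  Ext_eq0 n.+1 M N <-> exact (@hom_pre _ _ _ N (pr_d P n)) (hom_pre (pr_d P n.+1)).
Proof.
split=> [E f f0 | E P' f f0].
- have [|g gE] := E P f; last by exists (lin_hom g); apply: modHomP => x; exact/esym/gE.
  by move=> x; exact: (congr1 (fun h : modHom _ _ => h x) f0).
- have [phi [psi [s [phiE psiE sE]]]] := pr_homotopy_equiv P P'.
  have [|g gE] := E (lin_hom (f \o phi n.+1)).
    by apply: modHomP => x /=; rewrite -phiE f0.
  (* Apply [f] to the homotopy identity: the term through [pr_d P' n.+1] dies because [f] is a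
     cocycle, and the other two give this primitive. *)
  exists ((g : {linear _ -> _}) \o psi n \+ (f \o s n)) => x /=.
  rewrite [in LHS](sE n x) !linearD f0 add0r; congr (_ + _).
  have := congr1 (fun h : modHom _ _ => h (psi n.+1 x)) gE.
  by rewrite /= psiE.
Qed.

End Comparison.

Section Tor.
Variables (R : pzRingType) (V : lmodType R).
Implicit Types U W : lmodType R^c.

Lemma tensor_map_square U W W' U' (f : {linear U -> W}) (g : {linear W -> U'})
    (f' : {linear U -> W'}) (g' : {linear W' -> U'}) :
  (forall x, g (f x) = g' (f' x)) ->
  forall x : tensor U V, tensor_map g (tensor_map f x) = tensor_map g' (tensor_map f' x).
Proof.
move=> fg; apply: (@tensor_ext _ _ _ _ (tensor_map g \o tensor_map f)
  (tensor_map g' \o tensor_map f')).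
- by apply: zmor_comp; exact: tensor_mapB.
- by apply: zmor_comp; exact: tensor_mapB.
- by move=> u v; rewrite /= !tensor_mapE fg.
Qed.

Lemma zmor_add (A B : zmodType) (f g : A -> B) :
  zmod_morphism f -> zmod_morphism g -> zmod_morphism (fun x => f x + g x).
Proof. by move=> fB gB x y; rewrite fB gB opprD addrACA. Qed.

Lemma Tor_eq0P U (P : proj_res U) n :
  Tor_eq0 n.+1 U V <->
  exact (tensor_map (pr_d P n.+1) : _ -> tensor _ V) (tensor_map (pr_d P n)).
Proof.
split=> [E x x0 | E P' x x0]; first exact: E.
have [phi [psi [s [phiE psiE sE]]]] := pr_homotopy_equiv P P'.
have [|y yE] := E (tensor_map (psi n.+1) x).
  by rewrite (tensor_map_square (psiE n)) x0 (zmor0 (tensor_mapB _)).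
exists (tensor_map (phi n.+2) y + tensor_map (s n.+1) x).
rewrite (zmorD (tensor_mapB _)) (tensor_map_square (phiE n.+1)) yE.
(* The added last term is zero because [x] is a cycle. With it, the identity holds for every tensor
   and can be checked on pure tensors. *)
transitivity (tensor_map (phi n.+1) (tensor_map (psi n.+1) x) +
    (tensor_map (pr_d P' n.+1) (tensor_map (s n.+1) x) +
     tensor_map (s n) (tensor_map (pr_d P' n) x))).
  by rewrite x0 (zmor0 (tensor_mapB _)) addr0.
apply/esym; move: x {x0 yE}; apply: (@tensor_ext _ _ _ _ id) => //.
- by do !apply: zmor_add; apply: (@zmor_comp _ _ _ (tensor_map _) (tensor_map _));
    exact: tensor_mapB.
- by move=> u v; rewrite !tensor_mapE {1}(sE n u) !tensDl.
Qed.

End Tor.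

(** * Limit closure of the Auslander and Bass classes *)

Definition comp_nt (R S : pzRingType) (F G : functor S) (a : nattrans F G) (T : lfunctor R S) :
  nattrans (compf F T) (compf G T).
Proof.
apply: (@NatTrans _ (compf F T) (compf G T) (fun M => @ntr _ _ _ a (T M))).
- by move=> M; exact: (@ntrB _ _ _ a (T M)).
- by move=> M N f x; exact: (@ntr_nat _ _ _ a _ _ (lmap T f)).
Defined.

Section Classes.
Variables (S R : pzRingType) (C : bimodule S R).

Definition mu_nt : nattrans (Idf R) (compf (homf C) (btensorl C)).
Proof.
apply: (@NatTrans _ (Idf R) (compf (homf C) (btensorl C)) (fun M => @mu S R C M)).
- move=> M x y; apply: modHomP => c; exact: tens_zmorr.
- move=> M N f x; apply: modHomP => c; apply/esym; exact: tensor_maprE.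
Defined.

Definition nu_nt : nattrans (compf (tensorf (right_mod C)) (bhoml C)) (Idf S).
Proof.
apply: (@NatTrans _ (compf (tensorf (right_mod C)) (bhoml C)) (Idf S) (fun N => @nu S R C N)).
- by move=> N; exact/tensor_lift_zmod/nu_balanced.
- move=> M N f; apply: (@tensor_ext _ (right_mod C) (bhom C M) _
    (@nu S R C N \o tensor_mapr (lmap (bhoml C) f)) (f \o @nu S R C M)).
  + by apply: zmor_comp; [exact: tensor_maprB | exact/tensor_lift_zmod/nu_balanced].
  + by apply: zmor_comp; [exact/tensor_lift_zmod/nu_balanced | exact: raddfB].
  + by move=> c h; rewrite /= tensor_maprE !nuE.
Defined.

Hypothesis hC : semidualizing C.

(** The functor [T] is the identity for (A1) and [bhoml C] for (B2). *)
Lemma limclosed_Tor (Q : pzRingType) (T : lfunctor Q R) : bicontinuous (compf (Idf R) T) ->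
  limclosed (fun N => forall i, (1 <= i)%N -> Tor_eq0 i (right_mod C) (T N)).
Proof.
move=> gT; have [P fgP] := sd_a2 hC.
have gP n : bicontinuous (compf (tensorf (P n)) T).
  by apply: bicontinuous_compf gT _; apply: bicontinuous_tensorf_fgproj; [exact: pr_proj | exact: fgP].
apply: limclosed_forall => -[|n]; first by split.
have := limclosed_exact (comp_nt (tensor_map_nt (pr_d P n.+1)) T)
  (comp_nt (tensor_map_nt (pr_d P n)) T) (gP _) (gP _) (gP _).
apply: limclosed_ext => N; split=> [E _|/(_ isT) E]; exact/(Tor_eq0P _ P).
Qed.

(** The functor [T] is the identity for (B1) and [btensorl C] for (A2). *)
Lemma limclosed_Ext (Q : pzRingType) (T : lfunctor Q S) : bicontinuous (compf (Idf S) T) ->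
  limclosed (fun N => forall i, (1 <= i)%N -> Ext_eq0 i C (T N)).
Proof.
move=> gT; have [P fgP] := sd_a1 hC.
have gP n : bicontinuous (compf (homf (P n)) T).
  by apply: bicontinuous_compf gT _; apply: bicontinuous_homf_fgproj; [exact: pr_proj | exact: fgP].
apply: limclosed_forall => -[|n]; first by split.
have := limclosed_exact (comp_nt (hom_pre_nt (pr_d P n)) T)
  (comp_nt (hom_pre_nt (pr_d P n.+1)) T) (gP _) (gP _) (gP _).
apply: limclosed_ext => N; split=> [E _|/(_ isT) E]; exact/(Ext_eq0P _ P).
Qed.

Definition idl (Q : pzRingType) : lfunctor Q Q.
Proof. by apply: (@LFunctor Q Q (fun M => M) (fun M N f => f)). Defined.

(** The conditions see only the underlying groups and maps, which are those of
    [tensorf (right_mod C)]. *)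
Lemma bicontinuous_btensorl : bicontinuous (compf (Idf S) (btensorl C)).
Proof. by have [P /bicontinuous_tensorf[gP gL]] := sd_a2 hC; split; [exact: gP | exact: gL]. Qed.

Lemma bicontinuous_bhoml : bicontinuous (compf (Idf R) (bhoml C)).
Proof. by have [P /bicontinuous_homf[gP gL]] := sd_a1 hC; split; [exact: gP | exact: gL]. Qed.

Lemma limclosed_auslander : limclosed (auslander C).
Proof.
have [P fgP] := sd_a1 hC.
have gmu := bicontinuous_compf bicontinuous_btensorl (bicontinuous_homf fgP).
have gR : bicontinuous (compf (Idf R) (idl R)) by split.
apply: (limclosed_ext _ (limclosedI (limclosed_Tor gR)
  (limclosedI (limclosed_Ext bicontinuous_btensorl) (limclosed_bij mu_nt (bicontinuous_Idf R) gmu)))).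
by move=> M; split=> [[? [? ?]]|[? ? ?]].
Qed.

Lemma limclosed_bass : limclosed (bass C).
Proof.
have [P fgP] := sd_a2 hC.
have gnu := bicontinuous_compf bicontinuous_bhoml (bicontinuous_tensorf fgP).
have gS : bicontinuous (compf (Idf S) (idl S)) by split.
apply: (limclosed_ext _ (limclosedI (limclosed_Ext gS)
  (limclosedI (limclosed_Tor bicontinuous_bhoml) (limclosed_bij nu_nt gnu (bicontinuous_Idf S))))).
by move=> M; split=> [[? [? ?]]|[? ? ?]].
Qed.

End Classes.

(** * Elementwise description of products and colimits *)

Section QuotientModule.
Variables (R : pzRingType) (M : lmodType R) (N : submodule M).

Lemma smB x y : N x -> N y -> N (x - y).
Proof. by move=> xN yN; rewrite addrC -scaleN1r; exact: smP. Qed.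

Lemma smZ a x : N x -> N (a *: x).
Proof. by move=> xN; rewrite -[_ *: _]addr0; apply: smP => //; exact: sm0. Qed.

Definition sm_subgroup : subgroup M := Subgroup (sm0 N) smB.

Definition quotm : Type := quotz sm_subgroup.
HB.instance Definition _ := GRing.Zmodule.on quotm.

Definition quotm_pi (x : M) : quotm := quot_pi sm_subgroup x.

Let rp (x : quotm) : M := projT1 (cid (@quot_piS _ sm_subgroup x)).
Let rpK x : quotm_pi (rp x) = x.
Proof. exact: projT2 (cid (@quot_piS _ sm_subgroup x)). Qed.

Let qscale (a : R) (x : quotm) : quotm := quotm_pi (a *: rp x).

Let qscaleE a x : qscale a (quotm_pi x) = quotm_pi (a *: x).
Proof.
apply/(quot_pi_eq sm_subgroup); rewrite /= -scalerBr; apply: smZ.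
by apply/(quot_pi_eq sm_subgroup); exact: rpK.
Qed.

Let piD x y : quotm_pi (x + y) = quotm_pi x + quotm_pi y.
Proof. exact: (zmorD (@quot_piB _ sm_subgroup)). Qed.

Let qscaleA a b v : qscale a (qscale b v) = qscale (a * b) v.
Proof. by rewrite -[v]rpK !qscaleE scalerA. Qed.
Let qscale1 : left_id 1 qscale.
Proof. by move=> v; rewrite -[v]rpK qscaleE scale1r. Qed.
Let qscaleDr : right_distributive qscale +%R.
Proof. by move=> a x y; rewrite -[x]rpK -[y]rpK -piD !qscaleE -piD scalerDr. Qed.
Let qscaleDl v : {morph qscale^~ v: a b / a + b}.
Proof. by move=> a b; rewrite -[v]rpK !qscaleE -piD scalerDl. Qed.

HB.instance Definition _ := GRing.Zmodule_isLmodule.Build R quotm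
  qscaleA qscale1 qscaleDr qscaleDl.

Lemma quotm_pi_linear : linear quotm_pi.
Proof. by move=> a x y; rewrite piD; congr (_ + _); exact/esym/qscaleE. Qed.

Lemma quotm_pi_eq x y : quotm_pi x = quotm_pi y <-> N (x - y).
Proof. exact: (quot_pi_eq sm_subgroup). Qed.

End QuotientModule.

Section ProductModule.
Variables (R : pzRingType) (I : Type) (M : I -> lmodType R).

Definition prodm : Type := forall i, M i.

HB.instance Definition _ := gen_eqMixin prodm.
HB.instance Definition _ := gen_choiceMixin prodm.

Let padd (x y : prodm) : prodm := fun i => x i + y i.
Let popp (x : prodm) : prodm := fun i => - x i.
Let pzero : prodm := fun i => 0.
Let pscale (a : R) (x : prodm) : prodm := fun i => a *: x i.

Let paddA : associative padd.
Proof. by move=> x y z; apply: functional_extensionality_dep => i; exact: addrA. Qed.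
Let paddC : commutative padd.
Proof. by move=> x y; apply: functional_extensionality_dep => i; exact: addrC. Qed.
Let padd0 : left_id pzero padd.
Proof. by move=> x; apply: functional_extensionality_dep => i; exact: add0r. Qed.
Let paddN : left_inverse pzero popp padd.
Proof. by move=> x; apply: functional_extensionality_dep => i; exact: addNr. Qed.

HB.instance Definition _ := GRing.isZmodule.Build prodm paddA paddC padd0 paddN.

Let pscaleA a b v : pscale a (pscale b v) = pscale (a * b) v.
Proof. by apply: functional_extensionality_dep => i; exact: scalerA. Qed.
Let pscale1 : left_id 1 pscale.
Proof. by move=> v; apply: functional_extensionality_dep => i; exact: scale1r. Qed.
Let pscaleDr : right_distributive pscale +%R.
Proof. by move=> a x y; apply: functional_extensionality_dep => i; exact: scalerDr. Qed.
Let pscaleDl v : {morph pscale^~ v: a b / a + b}.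
Proof. by move=> a b; apply: functional_extensionality_dep => i; exact: scalerDl. Qed.

HB.instance Definition _ := GRing.Zmodule_isLmodule.Build R prodm
  pscaleA pscale1 pscaleDr pscaleDl.

End ProductModule.

Section Limits.
Variable R : pzRingType.

Lemma scale_linear (M : lmodType R) (m : M) : linear (fun r : R^o => (r : R) *: m).
Proof. by move=> a x y; rewrite scalerDl scalerA. Qed.

(** Elements of a module are linear maps out of [R^o], so the universal property is tested on
    [R^o]. *)
Lemma is_product_prodcone I (M : I -> lmodType R) (P : lmodType R)
    (p : forall i, {linear P -> M i}) : is_product p -> prodcone (Idf R) p.
Proof.
move=> pp; split=> [x x0 | y].
- have [h [_ hu]] := pp R^o (fun i => \0).
  have xh : mk_linear (scale_linear x) =1 h.
    by apply: hu => i r; rewrite /= linearZ /= (x0 i : p i x = 0) scaler0.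
  have zh : \0 =1 h by apply: hu => i r; rewrite /= linear0.
  by rewrite -[x]scale1r -[LHS]/(mk_linear (scale_linear x) 1) xh -zh.
- have [h [hE _]] := pp R^o (fun i => mk_linear (scale_linear (y i))).
  by exists (h 1) => i; rewrite /= hE /= scale1r.
Qed.

(** The injections factor through [N]; by uniqueness, the induced map into [N] followed by the
    inclusion is the identity of [Q]. *)
Lemma is_coproduct_ind I (M : I -> lmodType R) (Q : lmodType R)
    (q : forall i, {linear M i -> Q}) (N : submodule Q) :
  is_coproduct q -> (forall i x, N (q i x)) -> forall x, N x.
Proof.
move=> qq Nq x; have [h [hE _]] := qq (subm N) (fun i => sm_corestr (Nq i)).
have [k [_ ku]] := qq Q q.
suff -> : x = sm_val (h x) by exact: sm_valN.
rewrite -[LHS]/(idfun x) ku // -(ku (@sm_incl _ _ N \o h)) // => i y /=.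
by rewrite hE.
Qed.

Section Filtered.
Variables (J : category) (D : diagram R J).
Hypothesis fJ : filtered J.

Lemma filtered_span (k l l' : J) (w : cat_hom k l) (w' : cat_hom k l') :
  exists m (a : cat_hom l m) (b : cat_hom l' m), cat_comp w a = cat_comp w' b.
Proof.
have [_ ub eq] := fJ; have [m [a [b _]]] := ub l l'.
have [n [c cE]] := eq _ _ (cat_comp w a) (cat_comp w' b).
by exists n, (cat_comp a c), (cat_comp b c); rewrite !cat_assoc.
Qed.

Definition dies k (m : D k) : Prop := exists l (w : cat_hom k l), dg_map D w m = 0.

Lemma dies_linear k a (x y : D k) : dies x -> dies y -> dies (a *: x + y).
Proof.
move=> [l [w wx]] [l' [w' wy]]; have [m [c [c' cE]]] := filtered_span w w'.
exists m, (cat_comp w c); rewrite linearP {2}cE !dg_comp wx wy !linear0.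
by rewrite scaler0 addr0.
Qed.

(** The product of all [D k] modulo these families receives a cocone that detects vanishing, and so
    replaces an explicit construction of the colimit. *)
Definition eventually_dies : submodule (prodm D).
Proof.
apply: (@Submodule R (prodm D) (fun x => exists k0, forall k (u : cat_hom k0 k), dies (x k))).
- have [[k _] _ _] := fJ; exists k => l _; exists l, (cat_id l); exact: linear0.
- move=> a x y [k kx] [l ly]; have [_ ub _] := fJ; have [m [u [v _]]] := ub k l.
  exists m => n w; apply: dies_linear.
    exact: kx (cat_comp u w).
  exact: ly (cat_comp v w).
Defined.

(* [f j m] is the family of images of [m] under one chosen arrow [j -> k] for
   each [k] (0 if there is none). Different choices agree only after a further
   arrow, so this is a cocone only modulo [eventually_dies]. *)
Lemma detecting_cocone : exists f : forall j, {linear D j -> quotm eventually_dies},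
  is_cocone f /\ (forall j m, f j m = 0 -> dies m).
Proof.
have [t tE] : exists t : forall jk : J * J, {linear D jk.1 -> D jk.2},
    forall jk (u : cat_hom jk.1 jk.2), exists u', forall x, t jk x = dg_map D u' x.
  apply: (dep_choice (P := fun jk (t : {linear D jk.1 -> D jk.2}) =>
    forall u : cat_hom jk.1 jk.2, exists u', forall x, t x = dg_map D u' x)) => -[j k] /=.
  have [[u _]|no] := pselect (exists u : cat_hom j k, True).
    by exists (dg_map D u) => _; exists u.
  by exists \0 => u; case: no; exists u.
have fl j : linear (fun m : D j => quotm_pi eventually_dies (fun k => t (j, k) m)).
  move=> a x y; rewrite -quotm_pi_linear; congr quotm_pi.
  by apply: functional_extensionality_dep => k; exact: linearP.
exists (fun j => mk_linear (fl j)); split=> [i j v x | j m].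
- apply/quotm_pi_eq; exists j => k u; have [u1 u1E] := tE (j, k) u.
  have [u2 u2E] := tE (i, k) (cat_comp v u).
  have [_ _ eq] := fJ; have [l [w wE]] := eq _ _ (cat_comp v u1) u2.
  exists l, w; rewrite -[X in dg_map D w X]/(t (j, k) (dg_map D v x) - t (i, k) x).
  by rewrite u1E u2E -dg_comp linearB -!dg_comp wE subrr.
- rewrite -[0](linear0 (mk_linear (@quotm_pi_linear _ _ eventually_dies))).
  move=> /quotm_pi_eq; rewrite subr0 => -[k kd].
  have [_ ub _] := fJ; have [l [a [b _]]] := ub j k.
  have [l' [w]] := kd l b; have [u uE] := tE (j, l) a.
  by rewrite uE -dg_comp; exists l', (cat_comp u w).
Qed.

(** The elements coming from some stage form a submodule containing all images of [q], hence all of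
    [Q]. The detecting cocone factors through [Q], so an element that is zero in [Q] dies in the
    diagram. *)
Lemma is_colimit_dirlim (Q : lmodType R) (q : forall j, {linear D j -> Q}) :
  is_colimit q -> dirlim (Idf R) q.
Proof.
move=> [qc qq]; split=> [x | j m /= m0].
- have @N : submodule Q.
    apply: (@Submodule R Q (fun x => exists j (y : D j), q j y = x)).
    + by have [[j _] _ _] := fJ; exists j, 0; exact: linear0.
    + move=> a _ _ [j [y <-]] [k [z <-]]; have [_ ub _] := fJ.
      have [l [u [v _]]] := ub j k; exists l, (a *: dg_map D u y + dg_map D v z).
      by rewrite linearP !qc.
  have Nq j y : N (q j y) by exists j, y.
  have [|h [hE _]] := qq (subm N) (fun j => sm_corestr (Nq j)).
    by move=> i j u y; apply: sm_val_inj; exact: qc.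
  have [k [_ ku]] := qq Q q qc.
  suff -> : x = sm_val (h x) by exact: (sm_valN (h x)).
  rewrite -[LHS]/(idfun x) ku // -(ku (@sm_incl _ _ N \o h)) // => i y /=.
  by rewrite hE.
- have [f [fc fd]] := detecting_cocone; have [h [hE _]] := qq _ f fc.
  by apply: fd; rewrite -hE m0 linear0.
Qed.

End Filtered.

End Limits.

(** * Summands and coproducts *)

Lemma direct_summand_retract (R : pzRingType) (N M : lmodType R) :
  direct_summand N M ->
  exists (i : {linear N -> M}) (p : {linear M -> N}), forall x, p (i x) = x.
Proof.
move=> [N' [e [f fK eK]]].
(* The inverse [f] of [e] is only a function, so the retraction is obtained by factoring the first
   projection through [e]. *)
have [||p pE] := linear_factor (e := e) (g := fst : {linear (N * N')%type -> N}).
- by move=> y; exists (f y).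
- by move=> x ex; rewrite -[x]fK ex -(linear0 e) fK.
have il : linear (fun x : N => e (x, 0)).
  move=> a x y; rewrite -linearP; congr (e _).
  by apply: injective_projections; rewrite //= scaler0 addr0.
by exists (mk_linear il), p => x; rewrite /= pE.
Qed.

(* The one-object category with an idempotent ([true]) is filtered, and the
   colimit of a diagram over it is the image of the idempotent. *)
Section Idempotent.
Variables (R : pzRingType) (M : lmodType R) (e : {linear M -> M}).
Hypothesis eK : forall x, e (e x) = e x.

Definition bool_category : category.
Proof.
by apply: (@Category unit (fun _ _ => bool) (fun _ => false) (fun _ _ _ => orb)) => *;
  rewrite ?orbF ?orbA.
Defined.

Lemma filtered_bool : filtered bool_category.
Proof.
split; first by exists tt.
- by move=> [] []; exists tt, true, true.
- by move=> [] [] u v; exists tt, true; rewrite /= !orbT.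
Qed.

Definition idempotent_diagram : diagram R bool_category.
Proof.
apply: (@Diagram R bool_category (fun _ => M)
  (fun _ _ (b : bool) => if b then e else idfun)) => //.
by move=> _ _ _ [] [] x //=; rewrite eK.
Defined.

End Idempotent.

Section Closure.
Variables (R : pzRingType) (X : lmodType R -> Prop).
Hypothesis Xc : limclosed X.

(** A retract [N] is the colimit of the idempotent [i \o p] with cocone [p]: [x] comes from [i x],
    and an element killed by [p] is killed by the idempotent. *)
Lemma limclosed_summands : closed_summands X.
Proof.
move=> M N XM /direct_summand_retract[i [p pK]].
have eK x : (i \o p) ((i \o p) x) = (i \o p) x by rewrite /= pK.
apply: (lim_lim Xc (D := idempotent_diagram eK) (q := fun _ => p) filtered_bool) => //.
  by move=> _ _ [] x //=; rewrite pK.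
split=> [x | [] m /= m0]; first by exists tt, (i x); exact: pK.
by exists tt, true; rewrite /= m0 linear0.
Qed.

Lemma limclosed_products : closed_products X.
Proof. by move=> I M P p /is_product_prodcone; exact: lim_prod. Qed.

Lemma limclosed_colimits : closed_filtered_colimits X.
Proof. by move=> J D Q q fJ qq; apply: (lim_lim Xc fJ (proj1 qq)); exact: is_colimit_dirlim. Qed.

End Closure.

Lemma is_coproduct_proj (R : pzRingType) (I : Type) (M : I -> lmodType R) (Q : lmodType R)
    (q : forall i, {linear M i -> Q}) : is_coproduct q ->
  exists p : forall i, {linear Q -> M i},
    (forall i x, p i (q i x) = x) /\ (forall i j x, i <> j -> p i (q j x) = 0).
Proof.
move=> qq; suff /dep_choice[p pE] i : exists p : {linear Q -> M i},
    (forall x, p (q i x) = x) /\ (forall j x, i <> j -> p (q j x) = 0).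
  by exists p; split=> [i|i j]; [exact: (pE i).1 | exact: (pE i).2].
(* A Kronecker delta: the identity if [i = j], zero otherwise. The cast makes the first case
   typecheck for any proof of [i = j]. *)
have /dep_choice[f fE] j : exists f : {linear M j -> M i},
    (forall (e : i = j) x, f (ecast k (M k) e x) = x) /\ (i <> j -> forall x, f x = 0).
  have [<-|ij] := pselect (i = j).
    by exists idfun; split=> // e x; rewrite (Prop_irrelevance e erefl).
  by exists \0.
have [h [hE _]] := qq _ f; exists h; split=> [x|j x ij]; rewrite hE.
  exact: (fE i).1 erefl x.
exact: (fE j).2.
Qed.

Section Coproduct.
Variables (R : pzRingType) (I : Type) (M : I -> lmodType R) (Q : lmodType R).
Variables (q : forall i, {linear M i -> Q}) (p : forall i, {linear Q -> M i}).
Hypothesis qq : is_coproduct q.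
Hypothesis pq : forall i x, p i (q i x) = x.
Hypothesis pq0 : forall i j x, i <> j -> p i (q j x) = 0.

Local Notation I' := {classic I}.

(** Allowing every duplicate-free [t] containing [s] makes the condition monotone, so concatenating
    lists handles linear combinations. [{classic I}] supplies decidable equality. *)
Lemma coproduct_finite_support x : exists s : seq I', forall t : seq I',
  uniq t -> {subset s <= t} -> x = \sum_(i <- t) q i (p i x).
Proof.
have @N : submodule Q.
  apply: (@Submodule R Q (fun x => exists s : seq I', forall t : seq I',
    uniq t -> {subset s <= t} -> x = \sum_(i <- t) q i (p i x))).
  - by exists [::] => t _ _; rewrite big1 // => i _; rewrite !linear0.
  - move=> a y z [s sE] [s' s'E]; exists (s ++ s') => t tu st.
    rewrite {1}(sE t tu) => [|i si]; last by apply: st; rewrite mem_cat si.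
    rewrite {1}(s'E t tu) => [|i si]; last by apply: st; rewrite mem_cat si orbT.
    by rewrite scaler_sumr -big_split; apply: eq_bigr => i _; rewrite /= !linearP.
apply: (is_coproduct_ind (N := N) qq) => j y; exists [:: j : I'] => t tu jt.
rewrite (bigD1_seq (j : I')) ?jt ?mem_head //= pq big1 ?addr0 // => i /eqP ij.
by rewrite pq0 ?linear0.
Qed.

(** Lists stand for finite subsets ordered by inclusion. Arrows are proofs, so parallel arrows
    coincide by proof irrelevance. *)
Definition seq_category : category.
Proof.
by apply: (@Category (seq I') (fun s t => {subset s <= t}) (fun s i si => si)
  (fun s t u st tu i si => tu i (st i si))) => *; exact: Prop_irrelevance.
Defined.

Lemma filtered_seq : filtered seq_category.
Proof.
split; first by exists [::].
- move=> s t; exists (s ++ t); unshelve eexists.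
    by move=> i si; rewrite mem_cat si.
  by unshelve eexists => // i ti; rewrite mem_cat ti orbT.
- move=> s t u v; exists t, (cat_id (t : seq_category)).
  exact: (@Prop_irrelevance {subset s <= t}).
Qed.

Definition supported (s : seq I') : submodule Q.
Proof.
apply: (@Submodule R Q (fun x => forall i : I', i \notin s -> p i x = 0)).
- by move=> i _; exact: linear0.
- by move=> a x y x0 y0 i si; rewrite linearP x0 // y0 // scaler0 addr0.
Defined.

Lemma supported_sub s t (st : {subset s <= t}) (x : subm (supported s)) :
  supported t (sm_incl (supported s) x).
Proof. by move=> i it; apply: (sm_valN x); apply: contra it; exact: st. Qed.

Definition supported_diagram : diagram R seq_category.
Proof.
apply: (@Diagram R seq_category (fun s => subm (supported s))
  (fun s t st => sm_corestr (supported_sub st))).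
- by move=> s x; exact: val_inj.
- by move=> s t u st tu x; exact: val_inj.
Defined.

Lemma supported_dirlim :
  dirlim (Idf R) (D := supported_diagram) (fun s => sm_incl (supported s)).
Proof.
split=> [x | s m /= m0]; last by exists s, (cat_id (s : seq_category)); exact: val_inj.
have [s sE] := coproduct_finite_support x.
suff xs : supported (undup s) x by exists (undup s), (sm_mk xs).
move=> i si; rewrite (sE (undup s)) ?undup_uniq // => [|j]; last by rewrite mem_undup.
rewrite linear_sum big_seq big1 // => j sj; rewrite pq0 // => ij.
by move: si; rewrite ij sj.
Qed.

Lemma supported_prodcone (s : seq I') :
  prodcone (Idf R) (fun i : {i : I' | i \in s} => p (sval i) \o sm_incl (supported s)).
Proof.
split=> [x x0 | y].
- apply: val_inj; have [t tE] := coproduct_finite_support (sm_val x).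
  rewrite /= (tE (undup t)) ?undup_uniq // => [|j]; last by rewrite mem_undup.
  rewrite big1 // => i _; have [si|si] := boolP (i \in s).
    by rewrite (x0 (exist _ i si) : p i (sm_val x) = 0) linear0.
  by rewrite (sm_valN x i si) linear0.
(* The family [y] is extended by zero, and the sum below runs over [undup s] so that a repeated
   index counts once. *)
- pose z (i : I') : M i := if pselect (i \in s) is left si then y (exist _ i si) else 0.
  pose x := \sum_(i <- undup s) q i (z i).
  have xE i : i \in s -> p i x = z i.
    move=> si; rewrite linear_sum (bigD1_seq i) ?mem_undup ?undup_uniq //= pq.
    by rewrite big1 ?addr0 // => j /eqP ji; rewrite pq0 // => ij; apply: ji.
  have xs : supported s x.
    move=> i si; rewrite linear_sum big_seq big1 // => j; rewrite mem_undup => sj.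
    by rewrite pq0 // => ij; move: si; rewrite ij sj.
  exists (sm_mk xs) => -[i si]; rewrite -[LHS]/(p i x) xE // /z.
  by case: pselect => // si'; rewrite (Prop_irrelevance si si').
Qed.

End Coproduct.

Lemma limclosed_coproducts (R : pzRingType) (X : lmodType R -> Prop) :
  limclosed X -> closed_coproducts X.
Proof.
move=> Xc I M Q q qq XM; have [p [pq pq0]] := is_coproduct_proj qq.
apply: (lim_lim Xc (filtered_seq I) _ (supported_dirlim qq pq pq0)) => // s.
by apply: (lim_prod Xc (supported_prodcone qq pq pq0 s)) => i.
Qed.

(** * Finitely generated modules *)

Section FinitelyGenerated.
Variable R : pzRingType.

Lemma fin_gen_finType (M : lmodType R) (T : finType) (g : T -> M) :
  (forall m, exists a : T -> R, m = \sum_t a t *: g t) -> fin_gen M.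
Proof.
move=> gE; exists #|T|, (fun k => g (enum_val k)) => m; have [a ->] := gE m.
exists (fun k => a (enum_val k)); rewrite (reindex (@enum_val T T)) //=.
exact: onW_bij (enum_val_bij T).
Qed.

Lemma fin_gen_summand (M N : lmodType R) : fin_gen M -> direct_summand N M -> fin_gen N.
Proof.
move=> [n [g gE]] /direct_summand_retract[i [p pK]].
exists n, (fun k => p (g k)) => x; have [a aE] := gE (i x); exists a.
by rewrite -[x]pK aE linear_sum; apply: eq_bigr => k _; rewrite linearZ.
Qed.

Lemma fin_gen_sum (n : nat) (M : 'I_n -> lmodType R) (Q : lmodType R)
    (q : forall i, {linear M i -> Q}) :
  is_coproduct q -> (forall i, fin_gen (M i)) -> fin_gen Q.
Proof.
move=> qq /dep_choice[m /dep_choice[g gE]]; have [p [pq pq0]] := is_coproduct_proj qq.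
have qE x : x = \sum_i q i (p i x).
  have @N : submodule Q.
    apply: (@Submodule R Q (fun x => x = \sum_i q i (p i x))).
    - by rewrite big1 // => i _; rewrite !linear0.
    - move=> a y z yE zE; rewrite {1}yE {1}zE scaler_sumr -big_split.
      by apply: eq_bigr => i _; rewrite /= !linearP.
  apply: (is_coproduct_ind (N := N) qq) => j y /=.
  rewrite (bigD1 j) //= pq big1 ?addr0 // => i /eqP ij.
  by rewrite pq0 ?linear0.
(* The generators of [Q] are the images of all generators of all summands, indexed by dependent
   pairs. *)
apply: (@fin_gen_finType _ {i : 'I_n & 'I_(m i)} (fun t => q (tag t) (g _ (tagged t)))) => x.
have [a aE] := dep_choice (fun i => gE i (p i x)).
exists (fun t => a _ (tagged t)); rewrite [LHS]qE.
rewrite -(sig_big_dep xpredT (fun _ => xpredT) (fun i k => a i k *: q i (g i k))) /=.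
apply: eq_bigr => i _; rewrite aE linear_sum; apply: eq_bigr => k _.
exact: linearZ.
Qed.

End FinitelyGenerated.

Theorem proposition4p5 (S R : pzRingType) (C : bimodule S R)
    (hC : semidualizing C) :
  ([/\ closed_summands (auslander C),
       closed_products (auslander C),
       closed_coproducts (auslander C)
     & closed_filtered_colimits (auslander C)]
   /\
   [/\ closed_summands (bass C),
       closed_products (bass C),
       closed_coproducts (bass C)
     & closed_filtered_colimits (bass C)])
  /\
  ((closed_finite_sums (fg_part (auslander C)) /\
    closed_summands (fg_part (auslander C)))
   /\
   (closed_finite_sums (fg_part (bass C)) /\
    closed_summands (fg_part (bass C)))).
Proof.
(* Both finitely generated statements follow from limit closure alone: a finite sum is a coproduct,
   and finite generation passes to finite sums and summands. *)
have fg Q (X : lmodType Q -> Prop) : limclosed X ->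
    closed_finite_sums (fg_part X) /\ closed_summands (fg_part X).
  move=> Xc; split=> [n M P q qq XM | M N [XM fgM] MN].
  - split; first by apply: (limclosed_coproducts Xc qq) => i; exact: (XM i).1.
    by apply: (fin_gen_sum qq) => i; exact: (XM i).2.
  - by split; [exact: (limclosed_summands Xc XM) | exact: (fin_gen_summand fgM)].
have Ac := limclosed_auslander hC; have Bc := limclosed_bass hC.
split; split; try exact: fg; split.
all: by [exact: limclosed_summands | exact: limclosed_products
  | exact: limclosed_coproducts | exact: limclosed_colimits].
Qed.
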